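(* For a general $4$-dimensional smooth complete intersection $X$ of two quadrics in $\mathbb{P}^6$, there exists exactly one smooth conic in $X$ that meets each of the $2$-planes $S_{i,i+1}$ in $X$ for $0\le i\le 6$ (where $S_{6,7}$ means $S_{6,0}$).
   Context: Everything is over $\mathbb{C}$. Every $4$-dimensional smooth complete intersection of two quadrics in $\mathbb{P}^6$ can be written, in suitable homogeneous coordinates $Y_0,\dots,Y_6$, as $X=\{\sum_{i=0}^6Y_i^2=\sum_{i=0}^6\lambda_iY_i^2=0\}$ with $\lambda_0,\dots,\lambda_6\in\mathbb{C}$ pairwise distinct; ''general'' means for $(\lambda_0,\dots,\lambda_6)$ in a nonempty Zariski open subset of the parameter space. For each $i$ fix a square root of $\prod_{j\ne i}(\lambda_i-\lambda_j)$. Let $S\subset X$ be the $2$-plane defined by $\sum_{i=0}^6\lambda_i^kY_i/\sqrt{\prod_{j\neq i}(\lambda_i-\lambda_j)}=0$ for $0\le k\le 3$. For $I\subset\{0,\dots,6\}$, $S_I\subset X$ is the $2$-plane obtained from $S$ by reversing the signs of the homogeneous coordinates $Y_i$ for all $i\in I$; $S_{i,i+1}=S_{\{i,i+1\}}$ with indices modulo $7$. *)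

(* Defs.v *)
From mathcomp Require Import all_boot all_order all_algebra.
From mathcomp Require Import boolp classical_sets reals complex.
From mathcomp Require Import mpoly.

Set Implicit Arguments.
Unset Strict Implicit.
Unset Printing Implicit Defensive.

Import GRing.Theory.
Local Open Scope ring_scope.
Local Open Scope classical_set_scope.

(* P^n as the set of lines of F^(n+1); y \in val p means that y is 0 or a
   vector of homogeneous coordinates of p. *)
Definition proj (F : fieldType) (n : nat) :=
  {p : {vspace 'rV[F]_n.+1} | \dim p == 1%N}.

Definition zariski_open (F : fieldType) (n : nat) (U : set ('I_n -> F)) : Prop :=
  exists fs : set {mpoly F[n]}, U = [set x | exists2 f, fs f & f.@[x] != 0].

(* The row-free matrix A parametrizes a plane of P^n by P^2, and q is the
   equation of the conic in that plane. Smoothness is the Jacobian criterion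
   (it excludes q = 0, for which all partial derivatives vanish). *)
Definition smooth_conic (F : fieldType) (n : nat) (C : set (proj F n)) : Prop :=
  exists (A : 'M[F]_(3, n.+1)) (q : {mpoly F[3]}),
    [/\ row_free A,
        q \is 2.-homog,
        (forall v : 'rV[F]_3, v != 0 -> q.@[v 0] = 0 ->
           exists i : 'I_3, q^`M(i).@[v 0] != 0)
      & C = [set p : proj F n | exists2 v : 'rV[F]_3,
                       q.@[v 0] = 0 & val p = <[v *m A]>%VS]].

Definition two_quadrics (F : fieldType) (lam : 'I_7 -> F) : set (proj F 6) :=
  [set p : proj F 6 | forall y : 'rV[F]_7, y \in val p ->
     \sum_(i < 7) y 0 i ^+ 2 = 0 /\ \sum_(i < 7) lam i * y 0 i ^+ 2 = 0].

Definition is_sqrt_choice (F : fieldType) (lam s : 'I_7 -> F) : Prop :=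
  forall i, s i ^+ 2 = \prod_(j < 7 | j != i) (lam i - lam j).

Definition in_S (F : fieldType) (lam s : 'I_7 -> F) (y : 'rV[F]_7) : Prop :=
  forall k : nat, (k <= 3)%N -> \sum_(i < 7) lam i ^+ k * y 0 i / s i = 0.

Definition flip (F : fieldType) (I : {set 'I_7}) (y : 'rV[F]_7) : 'rV[F]_7 :=
  \row_i (if i \in I then - y 0 i else y 0 i).

(* As flip I is an involution, this preimage of S is also its image. *)
Definition plane_S (F : fieldType) (lam s : 'I_7 -> F) (I : {set 'I_7}) :
    set (proj F 6) :=
  [set p : proj F 6 | forall y : 'rV[F]_7, y \in val p -> in_S lam s (flip I y)].

(* Main.v *)
Require Import Defs.
From mathcomp Require Import all_boot all_order all_algebra.
From mathcomp Require Import boolp classical_sets reals complex.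
From mathcomp Require Import mpoly ring zify.
Local Open Scope ring_scope.
Local Open Scope classical_set_scope.

Set Implicit Arguments.
Unset Strict Implicit.
Unset Printing Implicit Defensive.
Import GRing.Theory Num.Theory.

(** Writing y_j = f(lam_j) / s_j identifies the plane S with the polynomials f
    of degree at most 2, and the linear forms vanishing on S with the cubic
    polynomials.  The plane P of a conic in X is isotropic for some member
    D = diag(b - a lam_j) of the pencil.

    If P does not meet S, then P is the left kernel of a unique bilinear form L
    with L + L^T = 2 D and L(-, S) = 0, and P meets S_{i,i+1} exactly when
    L(e_i, e_{i+1}) = 0.  When (a, b) varies, these forms L make up an
    8-dimensional space (two parameters a, b and the alternating forms on the
    4-dimensional quotient by S), so for general lam the seven conditions
    determine L up to a scalar.  Conversely, the left kernel of this L is a plane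
    that cuts X in a smooth conic, and it meets every S_{i,i+1}.

    If P meets S, then P = S, because otherwise two independent linear forms
    vanishing on P and S have a nonzero wedge product, which is an alternating
    solution of the seven equations with a = b = 0.  But P = S is excluded for the
    same reason: if the points (X - lam_i)(X - lam_{i+1}) of S lie on the conic
    q = 0, then (x - y) q((X - x)(X - y)) is again such an alternating solution. *)

(** * Residues and the space of forms L *)

Local Notation coord xi k := (xi (@Ordinal 8 k isT) 0).

Section Residues.
Variables (F : fieldType) (n : nat) (lam : 'I_n.+1 -> F).
Hypothesis lam_inj : injective lam.

Lemma poly_eq0_of_nodes (p : {poly F}) (A : {set 'I_n.+1}) :
  (size p <= #|A|)%N -> (forall i, i \in A -> p.[lam i] = 0) -> p = 0.
Proof.
move=> sp p0; apply: (@roots_geq_poly_eq0 _ _ [seq lam i | i <- enum A]).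
- by apply/allP => x /mapP [] i; rewrite mem_enum => iA ->; apply/rootP/p0.
- by rewrite map_inj_uniq // enum_uniq.
by rewrite size_map -cardE.
Qed.

(** Lagrange interpolation: p is the combination of the monic polynomials [l i], of degree n, with
    coefficients [p.[lam i] / w i]. The sum is therefore the coefficient of X^n in p, which is 0 as
    [size p <= n]. *)
Lemma sum_residues_eq0 (p : {poly F}) :
  (size p <= n)%N ->
  \sum_(i < n.+1) p.[lam i] / \prod_(j < n.+1 | j != i) (lam i - lam j) = 0.
Proof.
move=> sp; pose l i := \prod_(j < n.+1 | j != i) ('X - (lam j)%:P).
pose w i := \prod_(j < n.+1 | j != i) (lam i - lam j).
have sl i : size (l i) = n.+1.
  rewrite /l -big_filter size_prod_XsubC -sum1_size big_filter sum1_card.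
  by rewrite cardC1 card_ord.
have ml i : l i \is monic by apply: monic_prod_XsubC.
have w0 i : w i != 0.
  by apply/prodf_neq0 => j ji; rewrite subr_eq0 inj_eq // eq_sym.
have lE i j : (l i).[lam j] = if i == j then w i else 0.
  rewrite /l horner_prod; case: eqP => [->|/eqP ij].
    by apply: eq_bigr => k _; rewrite !hornerE.
  by rewrite (bigD1 j) 1?eq_sym //= !hornerE subrr mul0r.
pose q := p - \sum_i (p.[lam i] / w i) *: l i.
have q0 : q = 0.
  apply: (@poly_eq0_of_nodes _ [set: _]) => [|j _].
    rewrite cardsT card_ord (leq_trans (size_polyD _ _)) // geq_max size_polyN.
    rewrite (leq_trans sp) //= (leq_trans (size_sum _ _ _)) //.
    apply/bigmax_leqP => i _.
    by rewrite (leq_trans (size_scale_leq _ _)) ?sl.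
  rewrite /q !hornerE horner_sum (bigD1 j) //= !hornerE lE eqxx divfK //.
  rewrite big1 ?addr0 ?subrr // => i ij.
  by rewrite !hornerE lE (negPf ij) mulr0.
have /eqP : q`_n = 0 by rewrite q0 coef0.
rewrite coefB coef_sum nth_default // sub0r oppr_eq0 => /eqP sum0.
rewrite -[RHS]sum0; apply: eq_bigr => i _; rewrite coefZ.
by have /monicP := ml i; rewrite /lead_coef sl /= => ->; rewrite mulr1.
Qed.

End Residues.

Section Kernel.
Variables (R : comNzRingType) (lam : 'I_7 -> R).
Implicit Types (i j : 'I_7) (xi : 'cV[R]_8).

Definition side i := (i < 4)%N.

(* split_weight i j is lam j |-> P_i(lam j), where P_i, of degree at most 3,
   interpolates P'(lam i) at lam i and 0 at the nodes on the side of i, for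
   P = \prod_k (X - lam k); its values across the two sides are antisymmetric. *)
Definition split_weight i j :=
  \prod_(m < 7 | side m != side i) (lam i - lam m) *
  \prod_(k < 7 | (k != i) && (side k == side i)) (lam j - lam k).

(* kernel xi i j = s_i s_j L(e_i, e_j) for the form L with parameters xi. The
   first two coordinates of xi are (a, b); the others are the coefficients of the
   symmetric biquadratic polynomial q such that (x - y) q(x, y) is the
   alternating part. *)
Definition kernel_coef i j : 'rV[R]_8 :=
  let x := lam i in let y := lam j in
  \row_(k < 8) nth 0
    [:: - lam (if side i then i else j) * split_weight i j;
        split_weight i j; x - y; (x - y) * (x + y); (x - y) * (x * y);
        (x - y) * (x + y) ^+ 2; (x - y) * ((x + y) * (x * y));
        (x - y) * (x * y) ^+ 2] k.

Definition kernel xi i j := (kernel_coef i j *m xi) 0 0.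

(** The equations L(e_i, e_{i+1}) = 0 multiplied by s_i s_{i+1}: the square roots disappear and the
    entries become polynomials in lam. *)
Definition heptagon_mx : 'M[R]_(7, 8) :=
  \matrix_(i < 7) kernel_coef i (ordS i).

Lemma heptagon_mxP xi :
  heptagon_mx *m xi = 0 <-> forall i, kernel xi i (ordS i) = 0.
Proof.
have E i : (heptagon_mx *m xi) i 0 = kernel xi i (ordS i).
  by rewrite /kernel !mxE; apply: eq_bigr => k _; rewrite !mxE.
split=> [M0 i|M0]; first by rewrite -E M0 mxE.
by apply/matrixP => i j; rewrite ord1 E M0 mxE.
Qed.

(** These six products of x + y and x y span the symmetric polynomials of degree at most 2 in each
    variable; times x - y they span the alternating ones of degree at most 3, that is, the
    alternating forms on the quotient by S. *)
Definition biquad xi x y :=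
  coord xi 2 + coord xi 3 * (x + y)
  + coord xi 4 * (x * y) + coord xi 5 * (x + y) ^+ 2
  + coord xi 6 * ((x + y) * (x * y))
  + coord xi 7 * (x * y) ^+ 2.

Lemma kernelE xi i j :
  kernel xi i j =
  (coord xi 1
     - coord xi 0 * lam (if side i then i else j)) * split_weight i j
  + (lam i - lam j) * biquad xi (lam i) (lam j).
Proof.
(* Indexing xi by natural numbers identifies the ordinals built in different ways, so that [ring]
   sees the same atoms. *)
pose f k := xi (inord k) 0.
have fE (k : 'I_8) : xi k 0 = f k by rewrite /f inord_val.
rewrite /kernel mxE !big_ord_recl big_ord0 !mxE /biquad !fE /= /bump /=.
ring.
Qed.

End Kernel.

Lemma size_leD (R : nzRingType) n (p q : {poly R}) :
  (size p <= n)%N -> (size q <= n)%N -> (size (p + q)%R <= n)%N.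
Proof. by move=> pn qn; rewrite (leq_trans (size_polyD _ _)) // geq_max pn. Qed.

Lemma size_leM (R : nzRingType) m n (p q : {poly R}) :
  (size p <= m.+1)%N -> (size q <= n.+1)%N -> (size (p * q)%R <= (m + n).+1)%N.
Proof.
move=> pm qn; apply: leq_trans (size_polyMleq _ _) _.
by have := leq_add pm qn; rewrite addSn addnS; case: (_ + _)%N.
Qed.

Section KernelTheory.
Variables (R : comNzRingType) (lam : 'I_7 -> R).
Implicit Types (i j : 'I_7) (xi : 'cV[R]_8).

Lemma split_weight_diag i :
  split_weight lam i i = \prod_(j < 7 | j != i) (lam i - lam j).
Proof.
rewrite (bigID (fun j => side j != side i)) /=; congr (_ * _); apply: eq_bigl => j.
  by case: (eqVneq j i) => [->|//]; rewrite eqxx.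
by rewrite negbK.
Qed.

Lemma split_weight_same i j :
  i != j -> side i = side j -> split_weight lam i j = 0.
Proof.
move=> ij s_ij; rewrite /split_weight (bigD1 j (P := fun k => _ && _)) /=.
  by rewrite subrr mul0r mulr0.
by rewrite eq_sym ij s_ij eqxx.
Qed.

(** Across the two sides, [split_weight i j] is lam i - lam j times a product symmetric in i and j;
    within one side both values are 0. *)
Lemma split_weight_anti i j :
  i != j -> split_weight lam j i = - split_weight lam i j.
Proof.
move=> ij; have [s_ij|s_ij] := eqVneq (side i) (side j).
  by rewrite (split_weight_same ij) // split_weight_same ?oppr0 // eq_sym.
rewrite /split_weight (bigD1 i) //= [X in _ = - (X * _)](bigD1 j) 1?eq_sym //=.
have E (k l : 'I_7) : side k != side l -> forall m,
    (side m != side k) && (m != l) = (m != l) && (side m == side l).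
  by move=> kl m; rewrite andbC; congr (_ && _); move: kl; do 3!case: side.
have s_ji : side j != side i by rewrite eq_sym.
by rewrite (eq_bigl _ _ (E _ _ s_ij)) (eq_bigl _ _ (E _ _ s_ji)); ring.
Qed.

Lemma biquadC xi x y : biquad xi x y = biquad xi y x.
Proof. by rewrite /biquad; ring. Qed.

Lemma kernel_diag xi i :
  kernel lam xi i i = (coord xi 1 - coord xi 0 * lam i)
                      * \prod_(j < 7 | j != i) (lam i - lam j).
Proof. by rewrite kernelE if_same split_weight_diag subrr mul0r addr0. Qed.

Lemma kernel_anti xi i j : i != j -> kernel lam xi j i = - kernel lam xi i j.
Proof.
move=> ij; rewrite !kernelE biquadC; have [s_ij|s_ij] := eqVneq (side i) (side j).
  rewrite (split_weight_same ij) // split_weight_same //; first by ring.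
  by rewrite eq_sym.
(* For i and j on opposite sides, b - a x is evaluated in both orders at the node on the
   four-element side, so the linear factor is symmetric. *)
rewrite (split_weight_anti ij).
have -> : (if side j then j else i) = (if side i then i else j).
  by move: s_ij; do 2!case: side.
ring.
Qed.

Lemma side_card i :
  #|[pred k : 'I_7 | (k != i) && (side k == side i)]| = (if side i then 3 else 2).
Proof.
rewrite -sum1_card big_mkcond !big_ord_recl big_ord0.
by case: i; do 7?[case=> //].
Qed.

(** The split 4 + 3 keeps the degree at 3. On the side of four nodes the linear factor is constant
    along the row and multiplies a cubic; on the side of three it varies with lam j and multiplies a
    quadratic. The alternating part has degree at most 1 + 2 in lam j. *)
Lemma kernel_row xi i : exists2 p : {poly R},
  (size p <= 4)%N & forall j, kernel lam xi i j = p.[lam j].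
Proof.
pose f k := (xi k 0)%:P.
pose q := \prod_(k < 7 | (k != i) && (side k == side i)) ('X - (lam k)%:P).
pose c := \prod_(m < 7 | side m != side i) (lam i - lam m).
pose x := (lam i)%:P.
pose bq := f (@Ordinal 8 2 isT) + f (@Ordinal 8 3 isT) * (x + 'X)
  + f (@Ordinal 8 4 isT) * (x * 'X) + f (@Ordinal 8 5 isT) * (x + 'X) ^+ 2
  + f (@Ordinal 8 6 isT) * ((x + 'X) * (x * 'X))
  + f (@Ordinal 8 7 isT) * (x * 'X) ^+ 2.
pose l := f (@Ordinal 8 1 isT) - f (@Ordinal 8 0 isT) * (if side i then x else 'X).
have q_j j : q.[lam j] = \prod_(k < 7 | (k != i) && (side k == side i)) (lam j - lam k).
  by rewrite horner_prod; apply: eq_bigr => k _; rewrite !hornerE.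
exists (l * c%:P * q + (x - 'X) * bq) => [|j]; last first.
  rewrite kernelE hornerD !hornerM q_j /split_weight -/c mulrA; congr (_ * _ + _).
    by rewrite /l /f /x; case: side; rewrite !hornerE.
  by rewrite /biquad /bq /f /x !hornerE.
have sC (a : R) n : (size a%:P <= n.+1)%N.
  by rewrite (leq_trans (size_polyC_leq1 _)).
have sX : (size ('X : {poly R}) <= 2)%N by rewrite size_polyX.
have sx n : (size x <= n.+1)%N by apply: sC.
have sf k n : (size (f k) <= n.+1)%N by apply: sC.
have sxX : (size (x + 'X)%R <= 2)%N by apply: size_leD.
have sq : size q = (if side i then 4 else 3).
  by rewrite /q -big_filter size_prod_XsubC -sum1_size big_filter sum1_card side_card;
    case: side.
apply: size_leD.
  rewrite /l; case: side sq => sq.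
    apply: (@size_leM _ 0 3); last by rewrite sq.
    apply: (@size_leM _ 0 0) => //; apply: size_leD; rewrite ?size_polyN //.
    by apply: (@size_leM _ 0 0).
  apply: (@size_leM _ 1 2); last by rewrite sq.
  apply: (@size_leM _ 1 0) => //; apply: size_leD; rewrite ?size_polyN //.
  by apply: (@size_leM _ 0 1).
apply: (@size_leM _ 1 2); first by apply: size_leD; rewrite ?size_polyN.
have sxX2 : (size (x * 'X)%R <= 2)%N by apply: (@size_leM _ 0 1).
have sE (p : {poly R}) : (size p <= 2)%N -> (size (p ^+ 2) <= 3)%N.
  by move=> p2; rewrite expr2; apply: (@size_leM _ 1 1).
do !apply: size_leD => //; try by apply: (@size_leM _ 0 2) => //; apply: sE.
- by apply: (@size_leM _ 0 2) => //; apply: leq_trans sxX _.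
- by apply: (@size_leM _ 0 2) => //; apply: leq_trans sxX2 _.
by apply: (@size_leM _ 0 2) => //; apply: (@size_leM _ 1 1).
Qed.
End KernelTheory.

(** * ** The plane S, the pencil and the forms L as matrices *)

Section Planes.
Variables (F : fieldType) (lam s : 'I_7 -> F).
Hypotheses (lam_inj : injective lam) (s_sqrt : is_sqrt_choice lam s).
Implicit Types (i j : 'I_7) (xi : 'cV[F]_8) (y : 'rV[F]_7).

Lemma sqrt_neq0 i : s i != 0.
Proof.
have : s i ^+ 2 != 0; last by rewrite expf_eq0.
by rewrite s_sqrt; apply/prodf_neq0 => j ji; rewrite subr_eq0 inj_eq // eq_sym.
Qed.

Lemma sum_residues_sqrt_eq0 (p : {poly F}) :
  (size p <= 6)%N -> \sum_i p.[lam i] / s i ^+ 2 = 0.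
Proof.
move=> sp; rewrite -[RHS](sum_residues_eq0 lam_inj sp).
by apply: eq_bigr => i _; rewrite s_sqrt.
Qed.

(* The rows of moment_mx 3 span S; those of moment_mx 4 span the linear forms
   vanishing on S. *)
Definition moment_mx n : 'M[F]_(n, 7) := \matrix_(k < n, j < 7) (lam j ^+ k / s j).

Lemma moment_mxE n (u : 'rV[F]_n) j :
  (u *m moment_mx n) 0 j = (rVpoly u).[lam j] / s j.
Proof.
rewrite mxE /rVpoly horner_poly mulr_suml; apply: eq_bigr => k _.
by rewrite valK mxE mulrA.
Qed.

Lemma size_rVpoly n (u : 'rV[F]_n) : (size (rVpoly u) <= n)%N.
Proof. exact: size_poly. Qed.

Lemma moment_mx_nodes n y (A : {set 'I_7}) :
  (y <= moment_mx n)%MS -> (n <= #|A|)%N -> (forall j, j \in A -> y 0 j = 0) -> y = 0.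
Proof.
case/submxP => u -> nA y0; suff -> : u = 0 by rewrite mul0mx.
rewrite -(rVpolyK u) (@poly_eq0_of_nodes _ _ _ lam_inj (rVpoly u) A) ?linear0 //.
  exact: leq_trans (size_rVpoly u) nA.
move=> j /y0/eqP; rewrite moment_mxE mulf_eq0 invr_eq0 (negPf (sqrt_neq0 j)) orbF.
by move/eqP.
Qed.

Lemma moment_mx_free n : (n <= 7)%N -> row_free (moment_mx n).
Proof.
move=> n7; apply/inj_row_free => u uM0.
rewrite -(rVpolyK u) (@poly_eq0_of_nodes _ _ _ lam_inj (rVpoly u) [set: _]) ?linear0 //.
  by rewrite cardsT card_ord (leq_trans (size_rVpoly u)).
move=> j _; apply/eqP; move/rowP/(_ j)/eqP: uM0.
by rewrite moment_mxE mxE mulf_eq0 invr_eq0 (negPf (sqrt_neq0 j)) orbF.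
Qed.

(** The entries are residue sums of X^(k + l), whose degree is at most m + n - 2 <= 5. *)
Lemma moment_mx_orth m n : (m + n <= 7)%N -> moment_mx m *m (moment_mx n)^T = 0.
Proof.
move=> mn; apply/matrixP => k l; rewrite !mxE.
rewrite -[RHS](@sum_residues_sqrt_eq0 ('X^(k + l))).
  apply: eq_bigr => j _; by rewrite !mxE hornerXn exprD mulf_div expr2.
by rewrite size_polyXn; move: (ltn_ord k) (ltn_ord l) mn; lia.
Qed.

Lemma sub_moment_mx m n y : (m + n = 7)%N ->
  (y <= moment_mx m)%MS = (y *m (moment_mx n)^T == 0).
Proof.
move=> mn; have sub : (moment_mx m <= kermx (moment_mx n)^T)%MS.
  by apply/sub_kermxP/moment_mx_orth; rewrite mn.
rewrite -sub_kermx; apply/idP/idP => [/submx_trans-> //|/submx_trans-> //].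
rewrite -(mxrank_leqif_sup sub) mxrank_ker mxrank_tr.
rewrite (eqP (moment_mx_free _)) ?(eqP (moment_mx_free _)) -?mn ?leq_addr ?leq_addl //.
by rewrite addnK.
Qed.

Lemma in_SP y : in_S lam s y <-> (y <= moment_mx 3)%MS.
Proof.
rewrite (@sub_moment_mx 3 4) //; split=> [yS|/eqP y0 k k3].
  apply/eqP/rowP => k; rewrite !mxE -[RHS](yS k (ltn_ord k)).
  by apply: eq_bigr => j _; rewrite !mxE mulrA [y 0 j * _]mulrC.
move/rowP/(_ (Ordinal (k3 : k < 4)%N)): y0; rewrite !mxE => y0.
by rewrite -[RHS]y0; apply: eq_bigr => j _; rewrite !mxE mulrA [y 0 j * _]mulrC.
Qed.

Definition pencil_mx a b : 'M[F]_7 := diag_mx (\row_i (b - a * lam i)).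

Lemma tr_pencil_mx a b : (pencil_mx a b)^T = pencil_mx a b.
Proof. exact: tr_diag_mx. Qed.

Lemma pencil_mxE a b y j : (y *m pencil_mx a b) 0 j = y 0 j * (b - a * lam j).
Proof. by rewrite mul_mx_diag !mxE. Qed.

(** This is the inclusion of S in X: the entries are residue sums of polynomials of degree at most 1
    + 4. *)
Lemma moment_mx_isotropic a b :
  moment_mx 3 *m pencil_mx a b *m (moment_mx 3)^T = 0.
Proof.
apply/matrixP => k l; rewrite mul_mx_diag !mxE.
rewrite -[RHS](@sum_residues_sqrt_eq0 ((b%:P - a%:P * 'X) * 'X^(k + l))).
  apply: eq_bigr => j _; rewrite !mxE !(hornerM, hornerD, hornerN, hornerC, hornerX, hornerXn) exprD.
  by field; apply: sqrt_neq0.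
apply: (@size_leM _ 1 4).
  apply: size_leD; rewrite ?size_polyN.
    exact: leq_trans (size_polyC_leq1 _) _.
  apply: (@size_leM _ 0 1); last by rewrite size_polyX.
  exact: size_polyC_leq1.
by rewrite size_polyXn; move: (ltn_ord k) (ltn_ord l); lia.
Qed.

Definition polar_mx xi : 'M[F]_7 := \matrix_(i, j) (kernel lam xi i j / (s i * s j)).

Lemma polar_mx_tr xi :
  polar_mx xi + (polar_mx xi)^T =
  2%:R *: pencil_mx (coord xi 0) (coord xi 1).
Proof.
apply/matrixP => i j; rewrite !mxE; have [<-|ij] := eqVneq i j.
  rewrite kernel_diag -s_sqrt mulr1n.
  by field; apply: sqrt_neq0.
by rewrite (kernel_anti lam xi ij) /= [s j * _]mulrC mulNr subrr mulr0n mulr0.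
Qed.

(** Up to the s_j, a row of L is a polynomial of degree at most 3; paired with a quadratic from S it
    gives a residue sum of degree at most 5. *)
Lemma polar_mx_S xi : polar_mx xi *m (moment_mx 3)^T = 0.
Proof.
apply/matrixP => i k; rewrite !mxE; have [p sp pE] := kernel_row lam xi i.
transitivity ((s i)^-1 * \sum_j (p * 'X^k).[lam j] / s j ^+ 2).
  rewrite mulr_sumr; apply: eq_bigr => j _; rewrite !mxE pE hornerM hornerXn.
  by field; rewrite !sqrt_neq0.
rewrite sum_residues_sqrt_eq0 ?mulr0 //.
by apply: (@size_leM _ 3 2) => //; rewrite size_polyXn.
Qed.

Lemma S_polar_mx xi :
  moment_mx 3 *m polar_mx xi =
  2%:R *: (moment_mx 3 *m pencil_mx (coord xi 0) (coord xi 1)).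
Proof.
rewrite scalemxAr -polar_mx_tr mulmxDr -[X in _ = _ + X]trmxK trmx_mul trmxK.
by rewrite polar_mx_S trmx0 addr0.
Qed.

Lemma heptagon_polar_mx xi :
  heptagon_mx lam *m xi = 0 <-> forall i, polar_mx xi i (ordS i) = 0.
Proof.
rewrite heptagon_mxP; split=> K0 i; have := K0 i; rewrite mxE.
  by move=> ->; rewrite mul0r.
by move/eqP; rewrite mulf_eq0 invr_eq0 mulf_eq0 !(negPf (sqrt_neq0 _)) !orbF => /eqP.
Qed.

End Planes.

Lemma eqmx_row_free (F : fieldType) m n r (M : 'M[F]_(m, n)) :
  \rank M = r -> exists2 A : 'M[F]_(r, n), row_free A & (A :=: M)%MS.
Proof. by move=> <-; exists (row_base M); [exact: row_base_free | exact: eq_row_base]. Qed.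

Lemma row_neq0_sub (F : fieldType) m n (M : 'M[F]_(m, n)) :
  ~~ row_free M -> exists2 u : 'rV_m, u != 0 & u *m M = 0.
Proof.
move=> Mfree; have /rowV0Pn [u] : kermx M != 0 by rewrite kermx_eq0.
by move/sub_kermxP => uM u0; exists u.
Qed.

Section Flip.
Variable F : fieldType.
Implicit Types (I : {set 'I_7}) (y : 'rV[F]_7).

Lemma flipK I : involutive (@flip F I).
Proof. by move=> y; apply/rowP => j; rewrite /flip !mxE; case: (j \in I); rewrite ?opprK. Qed.

Definition flip_mx I : 'M[F]_7 := diag_mx (\row_j (if j \in I then -1 else 1)).

Lemma flip_mxE I y : y *m flip_mx I = flip I y.
Proof.
by apply/rowP => j; rewrite mul_mx_diag /flip !mxE; case: ifP; rewrite ?mulrN mulr1.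
Qed.

Lemma flip_eq0 I y : (flip I y == 0) = (y == 0).
Proof.
have f0 : flip I (0 : 'rV[F]_7) = 0 by rewrite -flip_mxE mul0mx.
by apply/eqP/eqP => [|->//]; rewrite -{2}[y](flipK I) => ->.
Qed.

End Flip.

(** * The plane defined by a solution *)

Section Existence.
Variables (F : fieldType) (lam s : 'I_7 -> F) (xi : 'cV[F]_8).
Hypotheses (lam_inj : injective lam) (s_sqrt : is_sqrt_choice lam s).
Hypothesis two_neq0 : 2%:R != 0 :> F.

Local Notation S := (moment_mx lam s 3).
Local Notation L := (polar_mx lam s xi).
Local Notation D := (pencil_mx lam (coord xi 0) (coord xi 1)).

Definition polar_minor : 'M[F]_(7, 4) :=
  \matrix_(i < 7, j < 4) L i (widen_ord (isT : (4 <= 7)%N) j).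

(** Each row of [Y *m L] kills S, so it comes from a polynomial of degree at most 3, and vanishing
    at the first four nodes makes it 0. *)
Lemma mul_polar_minor_eq0 m (Y : 'M[F]_(m, 7)) :
  (Y *m polar_minor == 0) = (Y *m L == 0).
Proof.
have E k j : (Y *m polar_minor) k j = (Y *m L) k (widen_ord (isT : (4 <= 7)%N) j).
  by rewrite !mxE; apply: eq_bigr => i _; rewrite !mxE.
apply/eqP/eqP => [Y0|Y0]; last by apply/matrixP => k j; rewrite E Y0 !mxE.
apply/row_matrixP => k; rewrite row0.
apply: (@moment_mx_nodes _ _ _ lam_inj s_sqrt 4 _ [set widen_ord (isT : (4 <= 7)%N) j | j : 'I_4]).
- rewrite (@sub_moment_mx _ _ _ lam_inj s_sqrt 4 3) // -row_mul -mulmxA.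
  by rewrite (polar_mx_S lam_inj s_sqrt) mulmx0 row0.
- by rewrite card_imset ?card_ord // => i j /(congr1 val) /= /val_inj.
by move=> _ /imsetP [] j _ ->; rewrite mxE -E Y0 mxE.
Qed.

Lemma polar_ker_isotropic m n (Y : 'M[F]_(m, 7)) (Z : 'M[F]_(n, 7)) :
  Y *m L = 0 -> Z *m L = 0 -> Y *m D *m Z^T = 0.
Proof.
move=> YL ZL; apply: (scalerI two_neq0); rewrite scaler0 scalemxAl scalemxAr.
rewrite -(polar_mx_tr lam_inj s_sqrt) mulmxDr YL add0r -mulmxA -trmx_mul ZL trmx0 mulmx0 //.
Qed.

Lemma polar_mx_diag i : L i i = D i i.
Proof.
have /matrixP/(_ i i) := polar_mx_tr lam_inj s_sqrt xi.
by rewrite !mxE -mulr2n -[LHS]mulr_natl; apply: mulfI.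
Qed.

Lemma polar_mx_anti i j : i != j -> L j i = - L i j.
Proof.
move=> ij; have /matrixP/(_ i j) := polar_mx_tr lam_inj s_sqrt xi.
by rewrite !mxE (negPf ij) mulr0n mulr0 => /eqP; rewrite addrC addr_eq0 => /eqP.
Qed.

Lemma ordS_neq (i : 'I_7) : i != ordS i.
Proof. by case: i; do 7?[case=> //]. Qed.

Lemma flip_pairE i (f : 'rV[F]_7) : flip [set i; ordS i]%SET f =
  f - (2%:R * f 0 i) *: delta_mx 0 i - (2%:R * f 0 (ordS i)) *: delta_mx 0 (ordS i).
Proof.
apply/rowP => j; rewrite /flip !mxE !inE eqxx /=.
have [->|ji] /= := eqVneq j i; first by rewrite (negPf (ordS_neq i)) /=; ring.
by have [->|ji'] /= := eqVneq j (ordS i); ring.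
Qed.

(** Flipping subtracts 2 f_i e_i + 2 f_{i+1} e_{i+1} from f, and f L = 2 f D on S because L + L^T =
    2 D and L(-, S) = 0. *)
Lemma polar_flip i j (f : 'rV[F]_7) : (f <= S)%MS ->
  (flip [set i; ordS i]%SET f *m L) 0 j =
  2%:R * (f 0 j * D j j - f 0 i * L i j - f 0 (ordS i) * L (ordS i) j).
Proof.
case/submxP => w ->{f}; set f := w *m S.
have fL : f *m L = 2%:R *: (f *m D).
  by rewrite /f -!mulmxA (S_polar_mx lam_inj s_sqrt) -scalemxAr.
rewrite flip_pairE !mulmxBl fL -!scalemxAl -!rowE !mxE.
rewrite (bigD1 j) //= big1 ?addr0 => [|k kj]; last by rewrite !mxE (negPf kj) mulr0n mulr0.
by rewrite !mxE eqxx mulr1n; ring.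
Qed.

Hypothesis xi_sol : forall i, L i (ordS i) = 0.

(* On S, the form f |-> L(flip f, -) kills S, e_i and e_{i+1}, so it has rank at
   most 2 and a kernel. *)
Lemma polar_ker_meets_plane i : exists f : 'rV[F]_7,
  [/\ f != 0, (f <= S)%MS & flip [set i; ordS i]%SET f *m L = 0].
Proof.
set I := [set i; ordS i]%SET.
pose N := row_mx S^T (row_mx (delta_mx i 0) (delta_mx (ordS i) 0) : 'M[F]_(7, 1 + 1)).
have ZN : S *m flip_mx F I *m L *m N = 0.
  apply/row_matrixP => k; rewrite row0 !row_mul flip_mxE /N !mul_mx_row.
  rewrite -mulmxA (polar_mx_S lam_inj s_sqrt) mulmx0.
  have kS : (row k S <= S)%MS by apply: row_sub.
  have col0 (v : 'rV[F]_7) j : v 0 j = 0 -> v *m delta_mx j 0 = 0 :> 'M_1.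
    by move=> v0; rewrite -colE; apply/matrixP => a b; rewrite !ord1 !mxE.
  (* In the entries at i and i + 1, the terms in D cancel because L and D have the same diagonal;
     what remains is a multiple of L(e_i, e_{i+1}). *)
  rewrite !col0 ?row_mx0 // polar_flip // ?polar_mx_diag.
    by rewrite xi_sol; ring.
  by rewrite (polar_mx_anti (ordS_neq i)) xi_sol; ring.
have rN : \rank N = 5%N.
  rewrite -mxrank_tr; apply/eqP; rewrite -/(row_free _).
  apply/inj_row_free => u; rewrite -[u]hsubmxK !tr_row_mx mul_row_col trmxK.
  set u1 := lsubmx u; set u2 := rsubmx u.
  rewrite -[u2]hsubmxK mul_row_col !trmx_delta => u0.
  (* A point of S supported on {i, i + 1} has a quadratic vanishing at the five other nodes. *)
  have f0 : u1 *m S = 0.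
    apply: (@moment_mx_nodes _ _ _ lam_inj s_sqrt 3 _ (~: I)) => [||j].
    - exact: submxMl.
    - by rewrite cardsCs finset.setCK card_ord cards2 ordS_neq.
    rewrite !inE negb_or => /andP [] ji ji'; move: u0; set w := u1 *m S.
    move/rowP/(_ j); rewrite !mxE !big_ord1 !mxE !eqxx (negPf ji) (negPf ji').
    by rewrite !mulr0 !addr0.
  move: u0; rewrite f0 add0r => /rowP u0.
  have u10 : u1 = 0.
    by apply: (row_free_inj (moment_mx_free lam_inj s_sqrt (isT : (3 <= 7)%N))); rewrite f0 mul0mx.
  have := u0 i; have := u0 (ordS i); rewrite !mxE !big_ord1 !mxE !eqxx /=.
  rewrite (negPf (ordS_neq i)) eq_sym (negPf (ordS_neq i)) !mulr0 !mulr1 addr0 add0r.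
  move=> u22 u21; rewrite u10 -[RHS]row_mx0; congr row_mx.
  by rewrite -[RHS]row_mx0; congr row_mx; apply/rowP => k; rewrite ord1 !mxE.
have rZ : ~~ row_free (S *m flip_mx F I *m L).
  apply/negP => /eqP rZ; have := mulmx0_rank_max ZN.
  by rewrite rZ rN.
have [u u0 uZ] := row_neq0_sub rZ.
exists (u *m S); split; last by rewrite -flip_mxE !mulmxA in uZ *.
  apply: contraNneq u0 => uS; apply/eqP.
  by apply: (row_free_inj (moment_mx_free lam_inj s_sqrt (isT : (3 <= 7)%N))); rewrite uS mul0mx.
exact: submxMl.
Qed.

Hypothesis minor_unit : polar_minor^T *m polar_minor \in unitmx.

Lemma rank_polar_minor : \rank polar_minor = 4.
Proof.
apply/eqP; rewrite eqn_leq rank_leq_col /=.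
by have := mxrankM_maxr polar_minor^T polar_minor; rewrite mxrank_unit.
Qed.

(** By dimension, the orthogonal of the plane is spanned by the columns of [polar_minor]. A vector
    of the plane orthogonal to the plane is thus a combination of these columns killed by their Gram
    matrix, which is invertible. *)
Lemma polar_plane : exists A : 'M[F]_(3, 7),
  [/\ row_free A, (A :=: kermx polar_minor)%MS & A *m A^T \in unitmx].
Proof.
have [|A Afree AK] := @eqmx_row_free _ _ _ 3 (kermx polar_minor).
  by rewrite mxrank_ker rank_polar_minor.
exists A; split=> //; rewrite -row_free_unit; apply/inj_row_free => v vA.
have AL : A *m polar_minor = 0 by apply/sub_kermxP; rewrite AK.
have sub : (polar_minor^T <= kermx A^T)%MS.
  by apply/sub_kermxP; rewrite -trmx_mul AL trmx0.
have : (v *m A <= polar_minor^T)%MS.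
  suff sup : (kermx A^T <= polar_minor^T)%MS.
    by apply: submx_trans sup; apply/sub_kermxP; rewrite -mulmxA.
  rewrite -(mxrank_leqif_sup sub) mxrank_ker !mxrank_tr rank_polar_minor.
  by rewrite (eqP Afree).
case/submxP => u vE; have uE : u *m (polar_minor^T *m polar_minor) = 0.
  by rewrite mulmxA -vE -mulmxA AL mulmx0.
apply: (row_free_inj Afree); rewrite vE mul0mx.
by rewrite -(mulmxK minor_unit u) uE !mul0mx.
Qed.

End Existence.

(** * Conics and symmetric matrices *)

Section QuadraticForms.
Variables (F : fieldType) (n : nat).
Hypothesis two_neq0 : 2%:R != 0 :> F.
Implicit Types (Q G : 'M[F]_n) (v : 'rV[F]_n).

Definition qform m (G : 'M[F]_m) (v : 'rV[F]_m) : F := (v *m G *m v^T) 0 0.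

Definition quad_mpoly Q : {mpoly F[n]} := \sum_i \sum_j Q i j *: ('X_i * 'X_j).

Lemma quad_mpoly_homog Q : quad_mpoly Q \is 2.-homog.
Proof.
apply: rpred_sum => i _; apply: rpred_sum => j _; apply: rpredZ.
by rewrite -mpolyXD dhomogX /= mdegD !mdeg1.
Qed.

Lemma meval_quad_mpoly Q v : (quad_mpoly Q).@[v 0] = qform Q v.
Proof.
transitivity (\sum_i \sum_j Q i j * (v 0 i * v 0 j)).
  rewrite raddf_sum; apply: eq_bigr => i _; rewrite raddf_sum; apply: eq_bigr => j _ /=.
  by rewrite mevalZ mevalM !mevalXU.
rewrite /qform mxE exchange_big; apply: eq_bigr => j _ /=.
by rewrite mxE mulr_suml; apply: eq_bigr => i _; rewrite mxE; ring.
Qed.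

Lemma mderiv_quad_mpoly Q v i : Q^T = Q ->
  (quad_mpoly Q)^`M(i).@[v 0] = 2%:R * (v *m Q) 0 i.
Proof.
move=> Qsym; have Qs a b : Q a b = Q b a by rewrite -{1}Qsym mxE.
have E a b : (Q a b *: ('X_a * 'X_b : {mpoly F[n]}))^`M(i).@[v 0] =
    (a == i)%:R * (v 0 b * Q b i) + (b == i)%:R * (v 0 a * Q a i).
  have dX c : ('X_c : {mpoly F[n]})^`M(i) = (c == i)%:R%:MP.
    rewrite mderivX mnm1E; case: eqP => [->|_]; last by rewrite scale0r.
    have -> : (U_(i) - U_(i) = 0 :> 'X_{1..n})%MM by apply/mnmP => k; rewrite !mnmE subnn.
    by rewrite scale1r mpolyX0.
  rewrite mderivZ mderivM !dX mevalZ mevalD !mevalM !mevalC !mevalXU.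
  have [->|_] := eqVneq a i; have [->|_] := eqVneq b i; rewrite ?(Qs i b) /=; ring.
rewrite [in RHS]mxE.
transitivity (\sum_a \sum_b ((a == i)%:R * (v 0 b * Q b i) + (b == i)%:R * (v 0 a * Q a i))).
  rewrite /quad_mpoly (raddf_sum (mderiv i)) (raddf_sum (meval (v 0))).
  apply: eq_bigr => a _; rewrite (raddf_sum (mderiv i)) (raddf_sum (meval (v 0))).
  by apply: eq_bigr => b _; apply: E.
under eq_bigr do rewrite big_split /=.
rewrite big_split mulr_natl mulr2n /=; congr (_ + _).
  rewrite (bigD1 i) //= [X in _ + X]big1 ?addr0 => [|a ai].
    by apply: eq_bigr => b _; rewrite eqxx mul1r.
  by rewrite big1 // => b _; rewrite (negPf ai) mul0r.
apply: eq_bigr => a _; rewrite (bigD1 i) //= big1 ?addr0 => [|b bi].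
  by rewrite eqxx mul1r.
by rewrite (negPf bi) mul0r.
Qed.

Lemma homog2_quad_mpoly (q : {mpoly F[n]}) :
  q \is 2.-homog -> exists2 Q : 'M[F]_n, Q^T = Q & q = quad_mpoly Q.
Proof.
(* Any coefficient matrix will do, since 2 is invertible and the matrix can be symmetrized. *)
move=> q2; suff [Q qE] : exists Q, q = quad_mpoly Q.
  exists (2%:R^-1 *: (Q + Q^T)); first by rewrite linearZ linearD /= trmxK addrC.
  have qT : quad_mpoly Q^T = quad_mpoly Q.
    rewrite /quad_mpoly exchange_big; apply: eq_bigr => i _; apply: eq_bigr => j _.
    by rewrite mxE mulrC.
  have -> : quad_mpoly (2%:R^-1 *: (Q + Q^T)) = 2%:R^-1 *: (quad_mpoly Q + quad_mpoly Q^T).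
    rewrite /quad_mpoly -big_split scaler_sumr; apply: eq_bigr => i _ /=.
    rewrite -big_split scaler_sumr; apply: eq_bigr => j _ /=.
    by rewrite !mxE -scalerDl scalerA.
  by rewrite qT -mulr2n -scaler_nat scalerA mulVf // scale1r.
have quad_mpolyD Q Q' : quad_mpoly (Q + Q') = quad_mpoly Q + quad_mpoly Q'.
  rewrite /quad_mpoly -big_split; apply: eq_bigr => i _ /=.
  by rewrite -big_split; apply: eq_bigr => j _ /=; rewrite mxE scalerDl.
rewrite [q]mpolyE big_seq; apply: (big_ind (fun p => exists Q, p = quad_mpoly Q)).
- exists 0; rewrite /quad_mpoly big1 // => i _; rewrite big1 // => j _.
  by rewrite mxE scale0r.
- by move=> _ _ [Q ->] [Q' ->]; exists (Q + Q').
move=> m mq; have m2 : mdeg m = 2%N.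
  apply/eqP; apply: contraTT mq => m2.
  by rewrite mcoeff_msupp (dhomog_nemf_coeff q2 m2) eqxx.
have [i mi] : exists i, (0 < m i)%N.
  apply/existsP; rewrite -[X in is_true X]negbK negb_exists; apply/negP => /forallP m0.
  move: m2; rewrite mdegE big1 // => i _; apply/eqP.
  by rewrite -leqn0 leqNgt; apply: m0.
have Ui : (U_(i) <= m)%MM.
  by apply/mnm_lepP => j; rewrite mnm1E; case: eqP => [<-|].
have /mdeg1P [j /eqP mj] : mdeg (m - U_(i)) == 1%N.
  by rewrite -(eqn_add2r (mdeg U_(i))) -mdegD submK // m2 mdeg1.
exists (q@_m *: delta_mx i j); rewrite /quad_mpoly (bigD1 i) //= [X in _ + X]big1 => [|k ki].
  rewrite addr0 (bigD1 j) //= big1 => [|l lj].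
    by rewrite !mxE !eqxx mulr1 addr0 -mpolyXD -mj addmC submK.
  by rewrite !mxE (negPf lj) andbF mulr0 scale0r.
by rewrite big1 // => l _; rewrite !mxE (negPf ki) mulr0 scale0r.
Qed.

End QuadraticForms.

(** * ** Quadratic forms vanishing on a smooth conic *)

Section Proportionality.
Variable F : fieldType.
Hypothesis two_neq0 : 2%:R != 0 :> F.

Definition smooth_form n (Q : 'M[F]_n) : Prop :=
  forall v : 'rV_n, v != 0 -> qform Q v = 0 -> v *m Q != 0.

Definition bform n (Q : 'M[F]_n) (u v : 'rV[F]_n) : F := (u *m Q *m v^T) 0 0.

Lemma bformDl n (Q : 'M[F]_n) u u' v : bform Q (u + u') v = bform Q u v + bform Q u' v.
Proof. by rewrite /bform !mulmxDl mxE. Qed.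

Lemma bformZl n (Q : 'M[F]_n) a u v : bform Q (a *: u) v = a * bform Q u v.
Proof. by rewrite /bform -!scalemxAl mxE. Qed.

Lemma bformDr n (Q : 'M[F]_n) u v v' : bform Q u (v + v') = bform Q u v + bform Q u v'.
Proof. by rewrite /bform linearD mulmxDr mxE. Qed.

Lemma bformZr n (Q : 'M[F]_n) a u v : bform Q u (a *: v) = a * bform Q u v.
Proof. by rewrite /bform linearZ /= -scalemxAr mxE. Qed.

Lemma bformC n (Q : 'M[F]_n) u v : Q^T = Q -> bform Q u v = bform Q v u.
Proof.
move=> Qs; rewrite /bform -[in LHS]Qs -[u in LHS]trmxK -!trmx_mul.
by rewrite mxE mulmxA.
Qed.

Lemma bform_eq0 n (Q : 'M[F]_n) u v : (u *m Q *m v^T = 0) <-> bform Q u v = 0.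
Proof.
by split=> [|b0]; [rewrite /bform => ->; rewrite mxE | apply/matrixP => i j; rewrite !ord1 [RHS]mxE].
Qed.

Definition bformE := (bformDl, bformDr, bformZl, bformZr).

(* A point u of the conic is completed to a basis u, m, w in which Q reads
   2 x z + d y^2; the conic is then parametrized by quadratic polynomials. *)
Lemma isotropic_frame (Q : 'M[F]_3) (u : 'rV_3) :
  Q^T = Q -> smooth_form Q -> u != 0 -> qform Q u = 0 ->
  exists m w : 'rV[F]_3,
    [/\ bform Q u w = 1, bform Q w w = 0, bform Q u m = 0, bform Q m w = 0
      & bform Q m m != 0] /\ row_full (col_mx u (col_mx m w)).
Proof.
move=> Qs Qsm u0 quu; have /rV0Pn [j uQj] := Qsm u u0 quu.
have [w0 uw0] : exists w0 : 'rV[F]_3, bform Q u w0 = 1.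
  exists (((u *m Q) 0 j)^-1 *: delta_mx 0 j).
  by rewrite bformZr /bform trmx_delta -colE [X in _ * X]mxE mulVf.
have uu : bform Q u u = 0 by [].
have [w [uw ww]] : exists w : 'rV[F]_3, bform Q u w = 1 /\ bform Q w w = 0.
  exists (w0 + (- (bform Q w0 w0 / 2%:R)) *: u).
  by rewrite !bformE uu (bformC w0 u Qs) uw0 mulr0 addr0; split=> //; field.
(* Orthogonality to u and w imposes two linear conditions on a 3-dimensional space. *)
have [m m0 mQ] : exists2 m : 'rV[F]_3, m != 0 &
    m *m (row_mx (Q *m u^T) (Q *m w^T) : 'M_(3, 1 + 1)) = 0.
  apply: row_neq0_sub; apply/negP => /eqP rk.
  by have := rank_leq_col (row_mx (Q *m u^T) (Q *m w^T)); rewrite rk.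
move: mQ; rewrite mul_mx_row -[RHS]row_mx0 => /eq_row_mx [].
rewrite !mulmxA => /bform_eq0 mu /bform_eq0 mw.
have um : bform Q u m = 0 by rewrite bformC.
have full : row_full (col_mx u (col_mx m w)).
  suff : row_free (col_mx u (col_mx m w) : 'M_(1 + (1 + 1), 3)) by rewrite /row_free /row_full.
  apply/inj_row_free => v; rewrite -[v]hsubmxK mul_row_col.
  rewrite -[rsubmx v]hsubmxK mul_row_col.
  set a := lsubmx v; set b := lsubmx _; set c := rsubmx _.
  have E (x : 'M[F]_1) (y : 'rV_3) : x *m y = x 0 0 *: y.
    by rewrite {1}[x]mx11_scalar mul_scalar_mx.
  rewrite !E => v0.
  have b0 y : bform Q (a 0 0 *: u + (b 0 0 *: m + c 0 0 *: w)) y = 0.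
    by rewrite v0 /bform !mul0mx mxE.
  have a0 : a 0 0 = 0 by have := b0 w; rewrite !bformE uw mw ww mulr1 !mulr0 !addr0.
  have c0 : c 0 0 = 0.
    by have := b0 u; rewrite !bformE uu mu (bformC w u Qs) uw mulr1 !mulr0 !add0r.
  move: v0; rewrite a0 c0 !scale0r add0r addr0 => /eqP.
  rewrite scaler_eq0 (negPf m0) orbF => /eqP b00.
  have Z (x : 'M[F]_1) : x 0 0 = 0 -> x = 0 
    by move=> x0; apply/matrixP => k l; rewrite !ord1 x0 mxE.
  by rewrite (Z a) // (Z b) // (Z c) // !row_mx0.
exists m, w; split=> //; split=> //; apply/eqP => mm.
have := Qsm m m0 mm; suff -> : m *m Q = 0 by rewrite eqxx.
have Tu : (col_mx u (col_mx m w))^T \in unitmx by rewrite unitmx_tr -row_full_unit.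
have Z y : bform Q m y = 0 -> m *m Q *m y^T = 0 by move/bform_eq0.
have mQT : m *m Q *m (col_mx u (col_mx m w))^T = 0 :> 'M_(1, 1 + (1 + 1)).
  by rewrite !tr_col_mx !mul_mx_row !Z // !row_mx0.
by rewrite -(mulmxK Tu (m *m Q)) mQT mul0mx.
Qed.

(** The constant c makes H = G - c Q vanish at (u, w). On the points -(d/2) y^2 u + y m + w of the
    conic, H is a polynomial of degree at most 3 in y without constant term; its values at 1, -1 and
    2 force the remaining entries of H to vanish. *)
Lemma smooth_qform_dvd (Q G : 'M[F]_3) (u : 'rV_3) :
  3%:R != 0 :> F -> Q^T = Q -> smooth_form Q -> u != 0 -> qform Q u = 0 ->
  G^T = G -> (forall v, qform Q v = 0 -> qform G v = 0) ->
  exists c, G = c *: Q.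
Proof.
move=> three_neq0 Qs Qsm u0 quu Gs Gv.
have [m [w [[uw ww um mw mm] full]]] := isotropic_frame Qs Qsm u0 quu.
pose c := bform G u w; exists c; apply/eqP; rewrite -subr_eq0; apply/eqP.
set H := G - c *: Q; set T := col_mx u _ in full.
have Hs : H^T = H by rewrite linearB linearZ /= Gs Qs.
have HE a b : bform H a b = bform G a b - c * bform Q a b.
  by rewrite /bform mulmxBr mulmxBl -scalemxAr -scalemxAl !mxE.
have Hv v : bform Q v v = 0 -> bform H v v = 0.
  by move=> qv; rewrite HE qv mulr0 subr0; apply: Gv.
have Huw : bform H u w = 0 by rewrite HE uw mulr1 subrr.
set d := bform Q m m in mm.
have Hy y : y ^+ 2 * bform H m m + 2%:R * y * bform H m w - d * y ^+ 3 * bform H u m = 0.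
  have := @Hv ((- (d / 2%:R) * y ^+ 2) *: u + (y *: m + w)).
  rewrite !bformE (bformC m u Qs) (bformC w u Qs) (bformC w m Qs) uw ww um mw.
  rewrite (quu : bform Q u u = 0) -/d.
  rewrite (bformC m u Hs) (bformC w u Hs) (bformC w m Hs) Huw -/d.
  rewrite (Hv u quu) (Hv w ww) => H0; rewrite -[RHS]H0; last by field.
  by field.
pose e y := y ^+ 2 * bform H m m + 2%:R * y * bform H m w - d * y ^+ 3 * bform H u m.
have e0 y : e y = 0 by apply: Hy.
have Hmm : bform H m m = 0.
  apply: (mulfI two_neq0); have -> : 2%:R * bform H m m = e 1 + e (-1) by rewrite /e; ring.
  by rewrite !e0 addr0 mulr0.
have Hum : bform H u m = 0.
  have : 2%:R * (3%:R * d) * bform H u m = 2%:R * e 1 - e 2%:R by rewrite /e Hmm; ring.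
  rewrite !e0 mulr0 subrr => /eqP.
  by rewrite !mulf_eq0 (negPf two_neq0) (negPf three_neq0) (negPf mm) /= => /eqP.
have Hmw : bform H m w = 0.
  apply: (mulfI two_neq0); have -> : 2%:R * bform H m w = e 1 by rewrite /e Hmm Hum; ring.
  by rewrite e0 mulr0.
have THT : T *m H *m T^T = 0 :> 'M_(1 + (1 + 1)).
  rewrite /T !tr_col_mx !mul_col_mx !mul_mx_row.
  have Z a b : bform H a b = 0 -> a *m H *m b^T = 0 by move/bform_eq0.
  rewrite !Z ?(Hv u quu) ?(Hv w ww) ?(bformC m u Hs) ?(bformC w u Hs) ?(bformC w m Hs) //.
  by rewrite !row_mx0 !col_mx0.
have Tu : (T : 'M_3) \in unitmx by rewrite -row_full_unit.
have Tu' : (T : 'M_3)^T \in unitmx by rewrite unitmx_tr.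
by rewrite -(mulKmx Tu H) -(mulmxK Tu' (T *m H)) THT mul0mx mulmx0.
Qed.

End Proportionality.

(** * Isotropic planes meeting the seven planes *)

Lemma row_free_extend (F : fieldType) m n (P : 'M[F]_(m, n)) :
  row_free P -> (m < n)%N -> exists x : 'rV[F]_n, row_free (col_mx P x).
Proof.
move=> Pfree mn; have /row_subPn [j xP] : ~~ (1%:M <= P)%MS.
  apply: contraTN mn => /mxrankS; rewrite mxrank1 (eqP Pfree).
  by rewrite -leqNgt.
exists (row j 1%:M); set x := row j _ in xP *.
apply/inj_row_free => v; rewrite -[v]hsubmxK mul_row_col.
set u := lsubmx v; rewrite [rsubmx v]mx11_scalar mul_scalar_mx; set c := rsubmx v 0 0.
move=> v0; have c0 : c = 0.
  apply: contraNeq xP => c0; rewrite -(eqmx_scale x c0).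
  by move/eqP: v0; rewrite addrC addr_eq0 => /eqP ->; rewrite -mulNmx submxMl.
move: v0; rewrite c0 scale0r addr0 => uP.
have -> : u = 0 by apply: (row_free_inj Pfree); rewrite uP mul0mx.
by rewrite raddf0 row_mx0.
Qed.

(* In a basis extending the rows of P by one vector x, the equation
   P *m X = C prescribes all entries of the alternating form X but the one at
   (x, x), which has to vanish. *)
Lemma antisymmetric_solve (F : fieldType) n (P C : 'M[F]_(n, n.+1)) :
  row_free P -> P *m C^T + C *m P^T = 0 ->
  exists2 X : 'M[F]_n.+1, X^T = - X & P *m X = C.
Proof.
move=> Pfree PC; have [x Tfree] := row_free_extend Pfree (leqnn _).
rewrite -addn1 in P C x Pfree Tfree PC *.
set T := col_mx P x in Tfree; have Tu : T \in unitmx by rewrite -row_free_unit.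
have Tu' : T^T \in unitmx by rewrite unitmx_tr.
pose B : 'M_(n + 1) := block_mx (C *m P^T) (C *m x^T) (- (x *m C^T)) 0.
have Bt : B^T = - B.
  rewrite /B tr_block_mx opp_block_mx !trmx_mul !trmxK trmx0 oppr0 linearN /=.
  rewrite !trmx_mul !trmxK; congr block_mx; last by rewrite opprK.
  by apply/eqP; rewrite -addr_eq0 PC.
exists (invmx T *m B *m (invmx T)^T).
  by rewrite !trmx_mul trmxK Bt mulNmx mulmxN mulmxA.
have -> : P = row_mx 1%:M 0 *m T by rewrite /T mul_row_col mul1mx mul0mx addr0.
rewrite trmx_inv !mulmxA mulmxK // mul_row_block !mul1mx !mul0mx !addr0.
by rewrite -mul_mx_row -tr_col_mx mulmxK.
Qed.

Section Alternating.
Variables (F : fieldType) (lam s : 'I_7 -> F).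
Hypotheses (lam_inj : injective lam) (s_sqrt : is_sqrt_choice lam s).
Hypothesis two_neq0 : 2%:R != 0 :> F.

(** The last six entries are the quotient of the alternating polynomial with coefficients X by x -
    y. The entry [x 0 3] occurs twice because x^3 - y^3 = (x - y) ((x + y)^2 - x y). *)
Definition alt_sol (a b : F) (X : 'M[F]_4) : 'cV[F]_8 :=
  let x k l := X (inord k) (inord l) in
  \col_k nth 0 [:: a; b; - x 0%N 1%N; - x 0%N 2%N; x 0%N 3%N - x 1%N 2%N;
    - x 0%N 3%N; - x 1%N 3%N; - x 2%N 3%N] k.

Lemma polar_alt_sol a b (X : 'M[F]_4) : X^T = - X ->
  polar_mx lam s (alt_sol a b X) =
  polar_mx lam s (alt_sol a b 0) + (moment_mx lam s 4)^T *m X *m moment_mx lam s 4.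
Proof.
move=> Xt; pose x k l := X (inord k) (inord l).
have XE (k l : 'I_4) : X k l = x k l by rewrite /x !inord_val.
have xC k l : x k l = - x l k.
  by have /matrixP/(_ (inord l) (inord k)) := Xt; rewrite !mxE.
have xD k : x k k = 0.
  apply: (mulfI two_neq0); rewrite mulr0 mulr_natl mulr2n.
  by rewrite {1}xC addNr.
apply/matrixP => i j; rewrite !mxE !kernelE /biquad /alt_sol !mxE /=.
have -> : \sum_j0 ((moment_mx lam s 4)^T *m X) i j0 * moment_mx lam s 4 j0 j =
  \sum_(l < 4) \sum_(k < 4) lam i ^+ k / s i * x k l * (lam j ^+ l / s j).
  apply: eq_bigr => l _; rewrite !mxE mulr_suml; apply: eq_bigr => k _.
  by rewrite !mxE XE.
rewrite !big_ord_recl !big_ord0 /= /bump /= !add1n !xD.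
rewrite -/(x 0%N 1%N) -/(x 0%N 2%N) -/(x 0%N 3%N) -/(x 1%N 2%N) -/(x 1%N 3%N) -/(x 2%N 3%N).
rewrite (xC 1%N 0%N) (xC 2%N 0%N) (xC 3%N 0%N) (xC 2%N 1%N) (xC 3%N 1%N) (xC 3%N 2%N).
by field; rewrite !(sqrt_neq0 lam_inj s_sqrt).
Qed.

End Alternating.

Section IsotropicPlane.
Variables (F : fieldType) (lam s : 'I_7 -> F).
Hypotheses (lam_inj : injective lam) (s_sqrt : is_sqrt_choice lam s).
Hypothesis two_neq0 : 2%:R != 0 :> F.

Local Notation S := (moment_mx lam s 3).
Local Notation H := (moment_mx lam s 4).
Local Notation D := (pencil_mx lam).

Variables (a b : F) (A : 'M[F]_(3, 7)).
Hypotheses (A_free : row_free A) (A_iso : A *m D a b *m A^T = 0).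
Hypothesis A_meets : forall i, exists f : 'rV[F]_7,
  [/\ f != 0, (f <= S)%MS & (flip [set i; ordS i]%SET f <= A)%MS].

Lemma flip_pair_id i (f : 'rV[F]_7) :
  f 0 i = 0 -> f 0 (ordS i) = 0 -> flip [set i; ordS i]%SET f = f.
Proof. by move=> fi fj; rewrite flip_pairE fi fj mulr0 !scale0r !subr0. Qed.

(** The form is sought as L0 + H^T X H with X alternating. Since L0 = C H, the condition A L = 0
    follows from (A H^T) X = - A C. Here A H^T is row-free because the rows of H cut out S, which A
    avoids, and the compatibility condition is the isotropy of A. *)
Lemma isotropic_plane_polar : (A :&: S)%MS = 0 ->
  exists xi : 'cV[F]_8, [/\ coord xi 0 = a, coord xi 1 = b,
    heptagon_mx lam *m xi = 0 & A *m polar_mx lam s xi = 0].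
Proof.
move=> AS0; pose L0 := polar_mx lam s (alt_sol a b 0).
have S_cap (v : 'rV[F]_7) : (v <= A)%MS -> (v <= S)%MS -> v = 0.
  by move=> vA vS; apply/eqP; rewrite -submx0 -AS0 sub_capmx vA.
have L0H : (L0 <= H)%MS.
  apply/row_subP => i; rewrite (sub_moment_mx lam_inj s_sqrt (m := 4) (n := 3)) //.
  by rewrite -row_mul (polar_mx_S lam_inj s_sqrt) row0.
have [C CE] : exists C : 'M_(7, 4), L0 = C *m H.
  by exists (L0 *m pinvmx H); rewrite mulmxKpV.
have [||X Xt PX] := @antisymmetric_solve _ _ (A *m H^T) (- (A *m C)).
- apply/inj_row_free => u uP; suff uA : u *m A = 0.
    by apply: (row_free_inj A_free); rewrite uA mul0mx.
  apply: S_cap; rewrite ?submxMl // (sub_moment_mx lam_inj s_sqrt (m := 3) (n := 4)) //.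
  by rewrite -mulmxA uP.
- rewrite linearN /= !trmx_mul trmxK mulmxN mulNmx -opprD.
  have -> : A *m H^T *m (C^T *m A^T) + A *m C *m (H *m A^T) = A *m (L0 + L0^T) *m A^T.
    by rewrite {2}CE CE trmx_mul mulmxDr mulmxDl !mulmxA addrC.
  rewrite (polar_mx_tr lam_inj s_sqrt) -scalemxAr -scalemxAl !mxE /=.
  by rewrite A_iso scaler0 oppr0.
pose xi := alt_sol a b X.
have AL : A *m polar_mx lam s xi = 0.
  rewrite (polar_alt_sol lam_inj s_sqrt two_neq0 _ _ Xt) mulmxDr -/L0 CE !mulmxA.
  by rewrite PX mulNmx subrr.
have [xi0 xi1] : coord xi 0 = a /\ coord xi 1 = b.
  by rewrite /xi /alt_sol !mxE.
exists xi; split=> //; apply/(heptagon_polar_mx lam_inj s_sqrt) => i.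
(* If L(e_i, e_{i+1}) were nonzero, the entries of L(flip f, -) at i and i + 1 would give f_{i+1} =
   f_i = 0; then f is its own flip and lies in both A and S. *)
have [f [f0 fS fA]] := A_meets i; apply/eqP; apply: contraT => Li.
have fL : flip [set i; ordS i]%SET f *m polar_mx lam s xi = 0.
  by case/submxP: fA => u ->; rewrite -mulmxA AL mulmx0.
have fLj j := congr1 (fun v : 'rV_7 => v 0 j) fL.
have fi : f 0 i = 0.
  have := fLj (ordS i); rewrite (polar_flip xi lam_inj s_sqrt _ _ fS) [RHS]mxE.
  rewrite -(polar_mx_diag xi lam_inj s_sqrt two_neq0) => /eqP.
  rewrite mulf_eq0 (negPf two_neq0) /= => /eqP E; apply: (mulIf Li); rewrite mul0r.
  by apply: oppr_inj; rewrite oppr0 -[RHS]E; ring.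
have fj : f 0 (ordS i) = 0.
  have := fLj i; rewrite (polar_flip xi lam_inj s_sqrt _ _ fS) [RHS]mxE.
  rewrite -(polar_mx_diag xi lam_inj s_sqrt two_neq0) fi => /eqP.
  rewrite (polar_mx_anti xi lam_inj s_sqrt (ordS_neq i)).
  rewrite mulf_eq0 (negPf two_neq0) /= => /eqP E; apply: (mulIf Li); rewrite mul0r.
  by rewrite -[RHS]E; ring.
by case/eqP: f0; apply: S_cap fS; rewrite -(flip_pair_id fi fj).
Qed.

End IsotropicPlane.

(** * ** Planes that meet S *)

Section Degenerate.
Variables (F : fieldType) (lam s : 'I_7 -> F).
Hypotheses (lam_inj : injective lam) (s_sqrt : is_sqrt_choice lam s).
Hypothesis two_neq0 : 2%:R != 0 :> F.
Hypothesis no_degenerate : forall xi : 'cV[F]_8, heptagon_mx lam *m xi = 0 ->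
  coord xi 0 = 0 -> coord xi 1 = 0 -> xi = 0.

Local Notation S := (moment_mx lam s 3).
Local Notation H := (moment_mx lam s 4).
Local Notation D := (pencil_mx lam).

(** H^T X H is the form L of [alt_sol 0 0 X], a solution with a = b = 0, and the entries of X can be
    read off from that solution. *)
Lemma alternating_eq0 (X : 'M[F]_4) : X^T = - X ->
  (forall i, (H^T *m X *m H) i (ordS i) = 0) -> X = 0.
Proof.
move=> Xt X0; pose xi := alt_sol 0 0 X.
have z0 : polar_mx lam s (alt_sol 0 0 0) = 0.
  have -> : alt_sol 0 0 0 = 0 :> 'cV[F]_8.
    apply/colP => k; rewrite /alt_sol !mxE oppr0 addr0.
    by case: k; do 8?[case=> //].
  by apply/matrixP => i j; rewrite !mxE /kernel mulmx0 !mxE mul0r.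
have xi0 : xi = 0.
  apply: no_degenerate; [|by rewrite mxE..].
  apply/(heptagon_polar_mx lam_inj s_sqrt) => i.
  by rewrite (polar_alt_sol lam_inj s_sqrt two_neq0 _ _ Xt) z0 add0r.
pose x k l := X (inord k) (inord l).
have xE k (hk : (k < 8)%N) : xi (Ordinal hk) 0 = 0 by rewrite xi0 mxE.
have xC k l : x k l = - x l k.
  by have /matrixP/(_ (inord l) (inord k)) := Xt; rewrite !mxE.
have xD k : x k k = 0.
  apply: (mulfI two_neq0); rewrite mulr0 mulr_natl mulr2n.
  by rewrite {1}xC addNr.
have N (t : F) : - t = 0 -> t = 0 by move/eqP; rewrite oppr_eq0 => /eqP.
have x01 : x 0%N 1%N = 0 by have := @xE 2%N isT; rewrite mxE /= => /N.
have x02 : x 0%N 2%N = 0 by have := @xE 3%N isT; rewrite mxE /= => /N.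
have x03 : x 0%N 3%N = 0 by have := @xE 5%N isT; rewrite mxE /= => /N.
have x12 : x 1%N 2%N = 0.
  by have := @xE 4%N isT; rewrite mxE /= -/(x 0%N 3%N) x03 sub0r => /N.
have x13 : x 1%N 3%N = 0 by have := @xE 6%N isT; rewrite mxE /= => /N.
have x23 : x 2%N 3%N = 0 by have := @xE 7%N isT; rewrite mxE /= => /N.
apply/matrixP => k l; rewrite mxE -[k]inord_val -[l]inord_val -/(x k l).
by move: (nat_of_ord k) (nat_of_ord l) (ltn_ord k) (ltn_ord l);
  do 5?[case=> //]; do 5?[case=> //];
  rewrite ?xD ?x01 ?x02 ?x03 ?x12 ?x13 ?x23 // xC ?x01 ?x02 ?x03 ?x12 ?x13 ?x23 oppr0.
Qed.

(** In terms of H, the wedge of the two rows is an alternating solution, hence 0, so the rows are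
    proportional. *)
Lemma no_wedge (N : 'M[F]_(2, 7)) : row_free N -> N *m S^T = 0 ->
  (forall i, N 0 i * N 1 (ordS i) = N 1 i * N 0 (ordS i)) -> False.
Proof.
move=> Nfree NS Nw.
have [h hE] : exists h : 'M_(2, 4), N = h *m H.
  exists (N *m pinvmx H); rewrite mulmxKpV //; apply/row_subP => i.
  by rewrite (sub_moment_mx lam_inj s_sqrt (m := 4) (n := 3)) // -row_mul NS row0.
pose X := (row 0 h)^T *m row 1 h - (row 1 h)^T *m row 0 h.
have rN k j : (row k h *m H) 0 j = N k j by rewrite -row_mul -hE mxE.
have X0 : X = 0.
  apply: alternating_eq0 => [|i].
    by rewrite /X linearB /= !trmx_mul !trmxK opprB.
  rewrite /X mulmxBr mulmxBl !mulmxA -!trmx_mul -!mulmxA.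
  rewrite mxE [X in _ + X]mxE.
  rewrite [X in X + _]mxE [X in _ - X]mxE !big_ord1.
  rewrite [X in X * _ - _]mxE [X in _ - X * _]mxE !rN Nw; ring.
have hC k l : h 0 k * h 1 l = h 1 k * h 0 l.
  apply/eqP; rewrite -subr_eq0; apply/eqP.
  by have /matrixP/(_ k l) := X0; rewrite !mxE !big_ord1 !mxE.
have hfree : row_free h.
  apply/inj_row_free => v vh; apply: (row_free_inj Nfree).
  by rewrite hE mulmxA vh !mul0mx.
have h1 : row 1 h != 0.
  apply/eqP => h1; have : delta_mx 0 1 = 0 :> 'rV[F]_2.
    by apply: (row_free_inj hfree); rewrite mul0mx -rowE.
  by move/matrixP/(_ 0 1)/eqP; rewrite !mxE !eqxx oner_eq0.
have /rV0Pn [l] := h1; rewrite mxE => hl.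
pose v : 'rV[F]_2 := \row_k (if k == 0 then h 1 l else - h 0 l).
have v0 : v = 0.
  apply: (row_free_inj hfree); rewrite mul0mx; apply/rowP => k.
  rewrite mxE big_ord_recl big_ord1 !mxE /=.
  by rewrite (_ : lift 0 0 = 1) ?[h 1 l * _]mulrC ?hC; [ring | apply: val_inj].
by case/eqP: hl; have /rowP/(_ 0) := v0; rewrite !mxE.
Qed.

(** At most one b - a lam j is 0, so the quadratic of f vanishes at six nodes or more. *)
Lemma pencil_mx_inj (a b : F) (f : 'rV[F]_7) : (a, b) != (0, 0) ->
  (f <= S)%MS -> f *m D a b = 0 -> f = 0.
Proof.
move=> ab fS fD.
apply: (moment_mx_nodes lam_inj s_sqrt (A := [set j | (b - a * lam j)%R != 0%R]%SET) fS).
  rewrite cardsCs -ltnS; have : (#|~: [set j | (b - a * lam j)%R != 0%R]%SET| <= 1)%N.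
    apply/card_le1_eqP => j k; rewrite !inE !negbK => /eqP bj /eqP bk.
    apply: lam_inj; apply/eqP; rewrite -subr_eq0; apply: contraNT ab => jk.
    have a0 : a = 0.
      apply: (mulIf jk); rewrite mul0r.
      have -> : a * (lam k - lam j) = (b - a * lam j) - (b - a * lam k) by ring.
      by rewrite bj bk subrr.
    by move: bj; rewrite a0 mul0r subr0 => ->; rewrite eqxx.
  by rewrite card_ord; move: #|_| => [|[|]].
move=> j; rewrite inE => bj; apply: (mulIf bj); rewrite mul0r -pencil_mxE fD mxE //.
Qed.

Lemma rank_pencil (a b : F) m (K : 'M[F]_(m, 7)) : (a, b) != (0, 0) ->
  (K <= S)%MS -> \rank (K *m D a b) = \rank K.
Proof.
move=> ab KS; apply/mxrank_injP/rowV0P => v.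
rewrite sub_capmx => /andP [] vK /sub_kermxP; apply: pencil_mx_inj ab _.
exact: submx_trans KS.
Qed.

Lemma intermediate_plane m n p (U : 'M[F]_(m, p)) (V : 'M[F]_(n, p)) :
  (U <= V)%MS -> (0 < \rank U <= 2)%N -> (2 <= \rank V)%N ->
  exists2 N : 'M[F]_(2, p), row_free N & (U <= N)%MS && (N <= V)%MS.
Proof.
move=> UV /andP [] U0 U2 V2; have [rU|rU] := eqVneq (\rank U) 2.
  have [N Nfree NE] := eqmx_row_free rU.
  by exists N; rewrite // !NE submx_refl.
have {U0 U2} rU : \rank U = 1%N by move: U0 U2 rU; case: (\rank U) => [|[|[|]]].
have [x xV xU] : exists2 x : 'rV_p, (x <= V)%MS & ~~ (x <= U)%MS.
  have /row_subPn [j jV] : ~~ (V <= U)%MS.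
    by apply: contraTN V2 => /mxrankS; rewrite rU -ltnNge ltnS.
  by exists (row j V); rewrite ?row_sub.
have [|N Nfree NE] := @eqmx_row_free _ _ _ 2 (U + x)%MS.
  apply/eqP; rewrite eqn_leq; apply/andP; split.
    by rewrite (leq_trans (mxrank_adds_leqif _ _)) // rU ltnS rank_leq_row.
  suff : (\rank U < \rank (U + x)%MS)%N by rewrite rU.
  rewrite ltn_neqAle mxrankS ?addsmxSl // andbT.
  apply: contra xU => /eqP rUx; apply: submx_trans (addsmxSr U x) _.
  by rewrite -(mxrank_leqif_sup (addsmxSl U x)) rUx.
by exists N; rewrite // !NE addsmxSl addsmx_sub UV.
Qed.

Section Plane.
Variables (a b : F) (A : 'M[F]_(3, 7)).
Hypothesis ab : (a, b) != (0, 0).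
Hypotheses (A_free : row_free A) (A_iso : A *m D a b *m A^T = 0).
Hypothesis A_meets : forall i, exists f : 'rV[F]_7,
  [/\ f != 0, (f <= S)%MS & (flip [set i; ordS i]%SET f <= A)%MS].

(** Otherwise K = A :&: S has rank 1 or 2, and the space V of linear forms vanishing on A + S has
    rank 1 + rank K >= 2. As A and S are isotropic, V contains K D. A plane N of forms between K D
    and V then contradicts [no_wedge]. *)
Lemma isotropic_plane_eqS : (A :&: S)%MS != 0 -> (A <= S)%MS.
Proof.
move=> K0; apply: contraT => AS; set K := (A :&: S)%MS in K0.
have rA : \rank A = 3 := eqP A_free.
have rS : \rank S = 3 := eqP (moment_mx_free lam_inj s_sqrt (isT : (3 <= 7)%N)).
have rK : (0 < \rank K <= 2)%N.
  suff : (\rank K < \rank A)%N by rewrite rA lt0n mxrank_eq0 K0.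
  rewrite ltn_neqAle mxrankS ?capmxSl // andbT.
  apply: contra AS => /eqP rKA; apply: submx_trans (capmxSr A S).
  by rewrite -(mxrank_leqif_sup (capmxSl A S)) rKA.
pose V := kermx (col_mx S A)^T.
have rV : (2 <= \rank V)%N.
  rewrite mxrank_ker mxrank_tr -addsmxE.
  have := mxrank_sum_cap A S; rewrite -/K rA rS addsmxC.
  by move/andP: rK => []; lia.
have KV : (K *m D a b <= V)%MS.
  apply/sub_kermxP; rewrite tr_col_mx mul_mx_row.
  have orth m (M : 'M_(m, 7)) : M *m D a b *m M^T = 0 -> (K <= M)%MS -> K *m D a b *m M^T = 0.
    by move=> M0 /submxP [] u ->; rewrite -!mulmxA (mulmxA M) M0 mulmx0.
  rewrite !orth ?capmxSl ?capmxSr ?row_mx0 //.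
  exact: moment_mx_isotropic.
have [|//|N Nfree /andP [] KN NV] := intermediate_plane KV.
  by rewrite rank_pencil ?capmxSr.
have [NS NA] : N *m S^T = 0 /\ N *m A^T = 0.
  move/sub_kermxP: NV; rewrite tr_col_mx mul_mx_row -[RHS]row_mx0.
  by move/eq_row_mx.
have orth (y : 'rV[F]_7) k (M : 'M_(3, 7)) :
    N *m M^T = 0 -> (y <= M)%MS -> \sum_j N k j * y 0 j = 0.
  move=> NM /submxP [u ->]; have : N *m (u *m M)^T = 0.
    by rewrite trmx_mul mulmxA NM mul0mx.
  by move/matrixP/(_ k 0); rewrite !mxE => E; rewrite -[RHS]E;
    apply: eq_bigr => j _; rewrite [in RHS]mxE.
exfalso; apply: (no_wedge Nfree NS) => i; have [f [f0 fS fA]] := A_meets i.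
(* If f_i = f_{i+1} = 0, then f lies in K and f D is a nonzero combination of the rows of N with
   zero entries at i and i + 1, so the minor of N there vanishes. *)
have [|fij] := boolP ((f 0 i == 0) && (f 0 (ordS i) == 0)).
  move=> /andP [] /eqP fi /eqP fj; rewrite (flip_pair_id fi fj) in fA.
  have : (f *m D a b <= N)%MS.
    by apply: submx_trans KN; apply: submxMr; rewrite sub_capmx fA.
  case/submxP => u uE; have u0 : u != 0.
    by apply: contraNneq f0 => u0; rewrite (pencil_mx_inj ab fS) // uE u0 mul0mx.
  have uN j : f 0 j = 0 -> u 0 0 * N 0 j + u 0 1 * N 1 j = 0.
    move=> fj0; have := pencil_mxE lam a b f j; rewrite fj0 mul0r uE mxE.
    by rewrite big_ord_recl big_ord1 (_ : lift 0 0 = 1) //; apply: val_inj.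
  have ui := uN _ fi; have uj := uN _ fj.
  have [u1|u1] := eqVneq (u 0 1) 0.
    have u00 : u 0 0 != 0.
      apply: contraNneq u0 => u00; apply/eqP/rowP => k; rewrite mxE.
      by case: k => [[|[|]]] //= hk; [rewrite -[RHS]u00 | rewrite -[RHS]u1];
        congr (u 0 _); apply: val_inj.
    move: ui uj; rewrite u1 !mul0r !addr0 => /eqP; rewrite mulf_eq0 (negPf u00) /= => /eqP ->.
    by move/eqP; rewrite mulf_eq0 (negPf u00) /= => /eqP ->; rewrite mul0r mulr0.
  apply: (mulfI u1); apply/eqP; rewrite -subr_eq0; apply/eqP.
  transitivity ((u 0 0 * N 0 (ordS i) + u 0 1 * N 1 (ordS i)) * N 0 i
    - (u 0 0 * N 0 i + u 0 1 * N 1 i) * N 0 (ordS i)); first by ring.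
  by rewrite ui uj !mul0r subr0.
(* Both f and its flip are killed by N, hence so is their difference 2 (f_i e_i + f_{i+1} e_{i+1});
   this is a linear relation between the two columns of N. *)
have fN k : f 0 i * N k i + f 0 (ordS i) * N k (ordS i) = 0.
  have E1 := orth f k _ NS fS; have E2 := orth _ k _ NA fA.
  apply: (mulfI two_neq0); rewrite mulr0 -[RHS](subrr 0) -[X in _ = X - _]E1 -[X in _ = _ - X]E2.
  rewrite -sumrB (bigD1 i) //= (bigD1 (ordS i)) /=; last by rewrite eq_sym ordS_neq.
  rewrite big1 => [|j /andP [] ji jj]; rewrite /flip !mxE !inE.
    by rewrite !eqxx orbT /=; ring.
  by rewrite (negPf ji) (negPf jj) /=; ring.
have f0N := fN 0; have f1N := fN 1; have [fi|fi] := eqVneq (f 0 i) 0.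
  have fj : f 0 (ordS i) != 0 by move: fij; rewrite fi eqxx.
  apply: (mulfI fj); apply/eqP; rewrite -subr_eq0; apply/eqP.
  transitivity ((f 0 i * N 1 i + f 0 (ordS i) * N 1 (ordS i)) * N 0 i
    - (f 0 i * N 0 i + f 0 (ordS i) * N 0 (ordS i)) * N 1 i); first by ring.
  by rewrite f0N f1N !mul0r subr0.
apply: (mulfI fi); apply/eqP; rewrite -subr_eq0; apply/eqP.
transitivity ((f 0 i * N 0 i + f 0 (ordS i) * N 0 (ordS i)) * N 1 (ordS i)
  - (f 0 i * N 1 i + f 0 (ordS i) * N 1 (ordS i)) * N 0 (ordS i)); first by ring.
by rewrite f0N f1N !mul0r subr0.
Qed.

End Plane.
End Degenerate.

(** * ** Conics in the plane S *)

Section ConicInS.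
Variables (F : fieldType) (lam s : 'I_7 -> F).
Hypotheses (lam_inj : injective lam) (s_sqrt : is_sqrt_choice lam s).
Hypothesis two_neq0 : 2%:R != 0 :> F.
Hypothesis no_degenerate : forall xi : 'cV[F]_8, heptagon_mx lam *m xi = 0 ->
  coord xi 0 = 0 -> coord xi 1 = 0 -> xi = 0.

Local Notation S := (moment_mx lam s 3).

(* The point of S in S_{i,i+1} is the quadratic (X - lam i) (X - lam (i + 1)). *)
Lemma S_flip_point i (w : 'rV[F]_3) :
  (flip [set i; ordS i]%SET (w *m S) <= S)%MS ->
  w = w 0 (inord 2) *: (\row_k nth 0 [:: lam i * lam (ordS i); - (lam i + lam (ordS i)); 1] k).
Proof.
set y := w *m S => yS.
have dS : (y - flip [set i; ordS i]%SET y <= S)%MS by rewrite addmx_sub ?eqmx_opp ?submxMl.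
(* The difference lies in S and vanishes at five nodes. Hence y is its own flip, and its quadratic
   has the roots lam i and lam (i + 1). *)
have d0 : y - flip [set i; ordS i]%SET y = 0.
  apply: (moment_mx_nodes lam_inj s_sqrt (A := ~: [set i; ordS i]%SET) dS).
    by rewrite cardsCs finset.setCK card_ord cards2 ordS_neq.
  by move=> j; rewrite !inE /flip !mxE !inE => /negPf ->; rewrite subrr.
have yE j : y 0 j = (rVpoly w).[lam j] / s j by apply: moment_mxE.
clearbody y.
have yj j : j \in [set i; ordS i]%SET -> (rVpoly w).[lam j] = 0.
  move=> jI; have := congr1 (fun v : 'rV_7 => v 0 j) d0.
  rewrite /flip !mxE jI opprK -mulr2n -mulr_natl => /eqP.
  rewrite mulf_eq0 (negPf two_neq0) /= yE mulf_eq0 invr_eq0.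
  by rewrite (negPf (sqrt_neq0 lam_inj s_sqrt j)) orbF => /eqP.
pose c k := w 0 (inord k).
have wE k : w 0 k = c k by rewrite /c inord_val.
have pE x : (rVpoly w).[x] = c 0%N + c 1%N * x + c 2%N * x ^+ 2.
  have -> : (rVpoly w).[x] = \sum_(k < 3) w 0 k * x ^+ k.
    by rewrite /rVpoly horner_poly; apply: eq_bigr => k _; rewrite valK.
  by rewrite !big_ord_recl big_ord0 !wE /= /bump /=; ring.
have := yj i; have := yj (ordS i); rewrite !inE !eqxx orbT !pE => /(_ isT) e2 /(_ isT) e1.
have ll : lam i - lam (ordS i) != 0 by rewrite subr_eq0 inj_eq // ordS_neq.
have c1 : c 1%N = - c 2%N * (lam i + lam (ordS i)).
  apply: (mulIf ll); apply/eqP; rewrite -subr_eq0; apply/eqP.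
  transitivity ((c 0%N + c 1%N * lam i + c 2%N * lam i ^+ 2) -
    (c 0%N + c 1%N * lam (ordS i) + c 2%N * lam (ordS i) ^+ 2)); first by ring.
  by rewrite e1 e2 subrr.
have c0 : c 0%N = c 2%N * (lam i * lam (ordS i)).
  apply/eqP; rewrite -subr_eq0; apply/eqP.
  rewrite -[RHS]e1 c1; ring.
apply/rowP => k; rewrite !mxE wE -/(c 2%N); case: k => [[|[|[|]]]] //= _.
- by rewrite c1; ring.
- by rewrite mulr1.
Qed.

Lemma no_conic_in_S (A : 'M[F]_(3, 7)) (Q : 'M[F]_3) :
  row_free A -> Q^T = Q -> smooth_form Q -> (A <= S)%MS ->
  (forall i, exists v : 'rV[F]_3,
    [/\ v != 0, qform Q v = 0 & (flip [set i; ordS i]%SET (v *m A) <= S)%MS]) -> False.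
Proof.
move=> Afree Qs Qsm AS Qv.
have SA : (S <= A)%MS.
  rewrite -(mxrank_leqif_sup AS) (eqP Afree).
  by rewrite (eqP (moment_mx_free lam_inj s_sqrt _)).
have /submxP [T TE] := SA; pose G := T *m Q *m T^T.
have Tu : T \in unitmx.
  rewrite -row_free_unit; apply/inj_row_free => u uT.
  apply: (row_free_inj (moment_mx_free lam_inj s_sqrt (isT : (3 <= 7)%N))).
  by rewrite TE mulmxA uT !mul0mx.
have Gs : G^T = G by rewrite /G !trmx_mul trmxK Qs mulmxA.
pose g k l := G (inord k) (inord l).
have gC k l : g k l = g l k by rewrite /g -{1}Gs mxE.
(* G is the equation of the conic in the coefficients of quadratics. Its value at (X - x) (X - y),
   with coefficients x y, -(x + y), 1, is [biquad xi x y]. *)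
pose xi : 'cV[F]_8 := \col_k nth 0
  [:: 0; 0; g 2%N 2%N; - 2%:R * g 1%N 2%N; 2%:R * g 0%N 2%N; g 1%N 1%N;
      - 2%:R * g 0%N 1%N; g 0%N 0%N] k.
have qGE (w : 'rV[F]_3) : qform G w = \sum_(l < 3) \sum_(k < 3) w 0 k * g k l * w 0 l.
  rewrite /qform mxE; apply: eq_bigr => l _; rewrite !mxE mulr_suml.
  by apply: eq_bigr => k _; rewrite /g !inord_val.
have xi0 : xi = 0.
  apply: no_degenerate; try by rewrite mxE.
  apply/heptagon_mxP => i; have [v [v0 Qv0 vS]] := Qv i.
  have /submxP [w wE] : (v *m A <= S)%MS by apply: submx_trans AS; apply: submxMl.
  have vE : v = w *m T by apply: (row_free_inj Afree); rewrite wE TE mulmxA.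
  rewrite wE in vS; have wP := S_flip_point vS; set c := w 0 (inord 2) in wP.
  have c0 : c != 0.
    by apply: contraNneq v0 => c0; rewrite vE wP c0 scale0r mul0mx.
  have qGw : qform G w = 0.
    by rewrite /qform /G -[RHS]Qv0 /qform vE trmx_mul !mulmxA.
  rewrite kernelE /biquad !mxE /= !mul0r subrr mul0r add0r.
  move: qGw; rewrite qGE wP !big_ord_recl !big_ord0 !mxE /= /bump /= !add1n.
  rewrite (gC 1%N 0%N) (gC 2%N 0%N) (gC 2%N 1%N) => E.
  apply: (mulfI c0); apply: (mulfI c0); rewrite !mulr0.
  by rewrite -[RHS](mulr0 (lam i - lam (ordS i))) -[X in _ = _ * X]E; ring.
have xE k (hk : (k < 8)%N) : xi (Ordinal hk) 0 = 0 by rewrite xi0 mxE.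
have N (t : F) : - 2%:R * t = 0 -> t = 0.
  by move/eqP; rewrite mulf_eq0 oppr_eq0 (negPf two_neq0) => /eqP.
have g22 : g 2%N 2%N = 0 by have := @xE 2%N isT; rewrite mxE.
have g12 : g 1%N 2%N = 0 by have := @xE 3%N isT; rewrite mxE /= => /N.
have g02 : g 0%N 2%N = 0.
  by have := @xE 4%N isT; rewrite mxE /= -[2%:R]opprK mulNr -mulNr => /eqP;
     rewrite mulNr oppr_eq0 => /eqP/N.
have g11 : g 1%N 1%N = 0 by have := @xE 5%N isT; rewrite mxE.
have g01 : g 0%N 1%N = 0 by have := @xE 6%N isT; rewrite mxE /= => /N.
have g00 : g 0%N 0%N = 0 by have := @xE 7%N isT; rewrite mxE.
have G0 : G = 0.
  apply/matrixP => k l; rewrite [RHS]mxE -[k]inord_val -[l]inord_val -/(g k l).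
  by move: (nat_of_ord k) (nat_of_ord l) (ltn_ord k) (ltn_ord l);
    do 4?[case=> //]; do 4?[case=> //];
    rewrite ?g00 ?g01 ?g02 ?g11 ?g12 ?g22 // gC ?g01 ?g02 ?g12.
have Q0 : Q = 0.
  have Tu' : T^T \in unitmx by rewrite unitmx_tr.
  by rewrite -(mulKmx Tu Q) -(mulmxK Tu' (T *m Q)) -/G G0 mul0mx mulmx0.
have d0 : delta_mx 0 0 != 0 :> 'rV[F]_3.
  by apply/eqP => /matrixP/(_ 0 0)/eqP; rewrite !mxE !eqxx oner_eq0.
have := Qsm _ d0; rewrite /qform Q0 mulmx0 mul0mx mxE eqxx => /(_ erefl) //.
Qed.

End ConicInS.

(** * The genericity polynomial *)

Section Discriminant.
Variables (R : comNzRingType) (lam : 'I_7 -> R).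

(* The signed maximal minors of heptagon_mx, as cofactors along a zero row, so
   that this solution is polynomial in lam. *)
Definition heptagon_sol : 'cV[R]_8 :=
  col 0 (\adj (col_mx 0 (heptagon_mx lam) : 'M_(1 + 7))).

(* The Gram matrix of the columns of polar_minor, with denominators cleared: it is
   regular when the quadric restricted to the left kernel of L is smooth. *)
Definition kernel_gram (xi : 'cV[R]_8) : 'M[R]_4 :=
  \matrix_(j, l) \sum_(i < 7)
    kernel lam xi i (widen_ord (isT : (4 <= 7)%N) j) *
    kernel lam xi i (widen_ord (isT : (4 <= 7)%N) l) *
    \prod_(m < 7 | m != i) \prod_(k < 7 | k != m) (lam m - lam k).

(** The three factors make the lam distinct, the seven equations independent with a solution such
    that a != 0, and the resulting conic smooth. *)
Definition genericity : R :=
  (\prod_(i < 7) \prod_(j < 7 | j != i) (lam i - lam j)) *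
  coord heptagon_sol 0 * \det (kernel_gram heptagon_sol).

Lemma heptagon_solP : heptagon_mx lam *m heptagon_sol = 0.
Proof.
have E : col_mx 0 (heptagon_mx lam) *m \adj (col_mx 0 (heptagon_mx lam) : 'M_(1 + 7))
    = 0 :> 'M_(1 + 7).
  rewrite mul_mx_adj (expand_det_row _ (lshift 7 (0 : 'I_1))) big1 ?raddf0 // => j _.
  by rewrite col_mxEu mxE mul0r.
move: E; rewrite mul_col_mx mul0mx -[RHS]col_mx0 => /eq_col_mx [] _ E.
by rewrite /heptagon_sol colE mulmxA E mul0mx.
Qed.

End Discriminant.

Section Naturality.
Variables (R T : comNzRingType) (f : {rmorphism R -> T}) (lam : 'I_7 -> R).

Lemma rmorph_kernel_coef i j :
  map_mx f (kernel_coef lam i j) = kernel_coef (f \o lam) i j.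
Proof.
have wE : f (split_weight lam i j) = split_weight (f \o lam) i j.
  rewrite rmorphM !rmorph_prod /=.
  by congr (_ * _); apply: eq_bigr => k _; rewrite rmorphB.
apply/rowP => k; rewrite !mxE; case: k => k hk /=.
do 8?[case: k hk => [|k] hk /=; first by
  rewrite !(wE, rmorphN, rmorphM, rmorphXn, rmorphB, rmorphD)].
by [].
Qed.

Lemma rmorph_kernel xi i j :
  f (kernel lam xi i j) = kernel (f \o lam) (map_mx f xi) i j.
Proof. by rewrite /kernel -rmorph_kernel_coef -map_mxM [RHS]mxE. Qed.

Lemma rmorph_heptagon_sol : map_mx f (heptagon_sol lam) = heptagon_sol (f \o lam).
Proof.
have E : map_mx f (col_mx 0 (heptagon_mx lam) : 'M_(1 + 7)) =
    col_mx 0 (heptagon_mx (f \o lam)).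
  rewrite map_col_mx map_mx0; congr col_mx; apply/row_matrixP => i.
  by rewrite -map_row !rowK rmorph_kernel_coef.
rewrite /heptagon_sol map_col map_mx_adj; congr (col 0 (\adj _)); exact: E.
Qed.

(** Taken with f the evaluation of polynomials at a point, this exhibits the generic locus as the
    nonvanishing set of one polynomial. *)
Lemma rmorph_genericity : f (genericity lam) = genericity (f \o lam).
Proof.
rewrite /genericity !rmorphM /= -det_map_mx -rmorph_heptagon_sol [in RHS]mxE.
have pE m : f (\prod_(k < 7 | k != m) (lam m - lam k)) =
    \prod_(k < 7 | k != m) ((f \o lam) m - (f \o lam) k).
  by rewrite rmorph_prod; apply: eq_bigr => k _; rewrite rmorphB.
congr (_ * _ * _); last congr determinant.
  by rewrite rmorph_prod; apply: eq_bigr => m _; apply: pE.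
apply/matrixP => j l; rewrite !mxE rmorph_sum; apply: eq_bigr => i _.
rewrite !rmorphM !rmorph_kernel rmorph_prod; congr (_ * _).
by apply: eq_bigr => m _; apply: pE.
Qed.

End Naturality.

Section FieldCase.
Variables (F : fieldType) (lam : 'I_7 -> F).

Lemma prod_diff_neq0 :
  (\prod_(i < 7) \prod_(j < 7 | j != i) (lam i - lam j) != 0) <-> injective lam.
Proof.
split=> [/prodf_neq0 p0 i j ij|lam_inj].
  apply/eqP; rewrite -[_ == _]negbK; apply/negP => ji.
  by have /prodf_neq0/(_ i ji) := p0 j isT; rewrite ij subrr eqxx.
apply/prodf_neq0 => i _; apply/prodf_neq0 => j ji.
by rewrite subr_eq0 inj_eq // eq_sym.
Qed.

(** Cofactors along the first row do not involve that row, so they are the same for the zero row of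
    [heptagon_sol] and for e_0. *)
Lemma det_heptagon : \det (col_mx (delta_mx 0 0) (heptagon_mx lam) : 'M_(1 + 7)) =
  coord (heptagon_sol lam) 0.
Proof.
have o0 : @Ordinal 8 0 isT = lshift 7 (0 : 'I_1) by apply: val_inj.
rewrite (expand_det_row _ (lshift 7 (0 : 'I_1))) (bigD1 (lshift 7 (0 : 'I_1))) //=.
rewrite big1 => [|j j0].
  rewrite addr0 col_mxEu mxE !eqxx mul1r o0 !mxE /cofactor; congr (_ * \det _).
  apply/matrixP => i j; rewrite !mxE; case: split_ordP => [k /(congr1 val) /=|//].
  by rewrite /bump leq0n; case: k => [] [].
by rewrite col_mxEu mxE /= (_ : (j == 0) = false) ?mul0r //; apply/negbTE.
Qed.

Hypothesis sol0 : coord (heptagon_sol lam) 0 != 0.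

Lemma heptagon_ker (xi : 'cV[F]_8) : heptagon_mx lam *m xi = 0 ->
  xi = (coord xi 0 / coord (heptagon_sol lam) 0) *: heptagon_sol lam.
Proof.
move=> xi0; have := det_heptagon; have := heptagon_solP lam.
move: (heptagon_sol lam) sol0 => sol sol_neq0 solP detE.
set c := _ / _; set M := col_mx (delta_mx 0 0) (heptagon_mx lam) : 'M_(1 + 7).
have Mu : M \in unitmx by rewrite unitmxE detE unitfE.
apply/eqP; rewrite -subr_eq0; apply/eqP; rewrite -(mulKmx Mu (xi - _)).
suff -> : M *m (xi - c *: sol) = 0 by rewrite mulmx0.
rewrite mulmxBr -scalemxAr /M !mul_col_mx xi0 solP.
rewrite scale_col_mx scaler0 opp_col_mx add_col_mx subr0 -[RHS]col_mx0; congr col_mx.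
rewrite -!rowE; apply/matrixP => i j; rewrite !mxE !ord1.
have o0 : (0 : 'I_8) = @Ordinal 8 0 isT by apply: val_inj.
by rewrite !o0 /c divfK // subrr.
Qed.

End FieldCase.

Section Gram.
Variables (F : fieldType) (lam s : 'I_7 -> F).
Hypotheses (lam_inj : injective lam).

Local Notation P' i := (\prod_(k < 7 | k != i) (lam i - lam k)).

(** As s_i^2 = P'(lam_i), this is the Gram matrix of the columns of [polar_minor] up to scaling by
    the s_j, written without square roots. *)
Definition residue_gram (xi : 'cV[F]_8) : 'M[F]_4 :=
  \matrix_(j, l) \sum_(i < 7)
    kernel lam xi i (widen_ord (isT : (4 <= 7)%N) j) *
    kernel lam xi i (widen_ord (isT : (4 <= 7)%N) l) / P' i.

Lemma kernel_gramE xi :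
  kernel_gram lam xi = (\prod_(m < 7) P' m) *: residue_gram xi.
Proof.
have p0 i : P' i != 0.
  by apply/prodf_neq0 => k ki; rewrite subr_eq0 inj_eq // eq_sym.
apply/matrixP => j l; rewrite !mxE mulr_sumr; apply: eq_bigr => i _.
have -> : \prod_(m < 7) P' m = P' i * \prod_(m < 7 | m != i) P' m by rewrite (bigD1 i).
have := p0 i; set p := P' i => p_neq0; set w := \prod_(m < 7 | _) _.
by field.
Qed.

Lemma residue_gram_polar xi : is_sqrt_choice lam s ->
  residue_gram xi \in unitmx ->
  (polar_minor lam s xi)^T *m polar_minor lam s xi \in unitmx.
Proof.
move=> s_sqrt Gu; pose d := diag_mx (\row_(j < 4) (s (widen_ord (isT : (4 <= 7)%N) j))^-1).
suff -> : (polar_minor lam s xi)^T *m polar_minor lam s xi = d *m residue_gram xi *m d.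
  rewrite !unitmx_mul Gu andbT andbb unitmxE det_diag unitfE; apply/prodf_neq0 => j _.
  by rewrite mxE invr_eq0 (sqrt_neq0 lam_inj s_sqrt).
apply/matrixP => j l; rewrite mul_mx_diag mul_diag_mx !mxE mulr_sumr mulr_suml.
apply: eq_bigr => i _; rewrite !mxE -s_sqrt.
by field; rewrite !(sqrt_neq0 lam_inj s_sqrt).
Qed.

End Gram.

(** * ** Nonvanishing at a sample point *)

Section SamplePoint.
Variable F : numFieldType.

(** In this order 1 and -1, 2 and -2, 3 and -3 are cyclically adjacent; x + y = 0 makes three of the
    seven equations sparse. *)
Definition sample_point (i : 'I_7) : F := nth 0 [:: - 3; 1; - 1; 2; - 2; 0; 3] i.

Local Notation o k := (@Ordinal 7 k isT).

Lemma kernel_mkcond lam xi i j :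
  kernel lam xi i j = (coord xi 1 - coord xi 0 * lam (if side i then i else j)) *
    ((\prod_(m < 7) if side m != side i then lam i - lam m else 1) *
     (\prod_(k < 7) if (k != i) && (side k == side i) then lam j - lam k else 1)) +
    (lam i - lam j) * biquad xi (lam i) (lam j) :> F.
Proof. by rewrite kernelE /split_weight big_mkcond [X in _ * (_ * X)]big_mkcond. Qed.

Lemma sample_point_inj : injective sample_point.
Proof.
pose l : seq int := [:: - 3; 1; - 1; 2; - 2; 0; 3].
have sE i : sample_point i = (nth 0 l i)%:~R.
  by rewrite /sample_point; case: i; do 7?[case=> [_ | ] //]; rewrite /= ?rmorphN.
move=> i j; rewrite !sE => /intr_inj/eqP; rewrite nth_uniq //.
by move=> /eqP; apply: val_inj.
Qed.

Ltac sample_kernel :=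
  rewrite kernel_mkcond !big_ord_recl !big_ord0 /biquad /sample_point /=.

Lemma sample_no_degenerate (xi : 'cV[F]_8) :
  heptagon_mx sample_point *m xi = 0 -> coord xi 0 = 0 -> xi = 0.
Proof.
move=> /heptagon_mxP K0 x0.
have K i j : ordS i = j -> kernel sample_point xi i j = 0 by move=> <-.
pose E0 := - 4 * coord xi 2 + 8 * coord xi 3 + 12 * coord xi 4 - 16 * coord xi 5
    - 24 * coord xi 6 - 36 * coord xi 7.
have e0 : E0 = 0.
  by rewrite -[RHS](K (o 0) (o 1)); [sample_kernel; rewrite /E0; ring | apply: val_inj].
pose E1 := 2 * coord xi 2 - 2 * coord xi 4 + 2 * coord xi 7.
have e1 : E1 = 0.
  by rewrite -[RHS](K (o 1) (o 2)); [sample_kernel; rewrite /E1; ring | apply: val_inj].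
pose E2 := - 3 * coord xi 2 - 3 * coord xi 3 + 6 * coord xi 4 - 3 * coord xi 5
    + 6 * coord xi 6 - 12 * coord xi 7.
have e2 : E2 = 0.
  by rewrite -[RHS](K (o 2) (o 3)); [sample_kernel; rewrite /E2; ring | apply: val_inj].
pose E3 := 48 * coord xi 0 - 24 * coord xi 1 + 4 * coord xi 2 - 16 * coord xi 4
    + 64 * coord xi 7.
have e3 : E3 = 0.
  by rewrite -[RHS](K (o 3) (o 4)); [sample_kernel; rewrite /E3; ring | apply: val_inj].
pose E4 := - 2 * coord xi 2 + 4 * coord xi 3 - 8 * coord xi 5.
have e4 : E4 = 0.
  by rewrite -[RHS](K (o 4) (o 5)); [sample_kernel; rewrite /E4; ring | apply: val_inj].
pose E5 := - 3 * coord xi 2 - 9 * coord xi 3 - 27 * coord xi 5.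
have e5 : E5 = 0.
  by rewrite -[RHS](K (o 5) (o 6)); [sample_kernel; rewrite /E5; ring | apply: val_inj].
pose E6 := 432 * coord xi 0 + 144 * coord xi 1 + 6 * coord xi 2 - 54 * coord xi 4
    + 486 * coord xi 7.
have e6 : E6 = 0.
  by rewrite -[RHS](K (o 6) (o 0)); [sample_kernel; rewrite /E6; ring | apply: val_inj].
(* With coordinate 0 equal to 0, the equations form a 7 by 7 system. The combinations below are the
   rows of its inverse multiplied by the common denominator 1440. *)
have n : 1440 != 0 :> F by rewrite pnatr_eq0.
have x1 : coord xi 1 = 0.
  apply: (mulfI n).
  transitivity (- 15 * E0 - 15 * E1 - 60 * E2 - 42 * E3 + 12 * E4 + 12 * E5 + 3 * E6).
    by rewrite /E0 /E1 /E2 /E3 /E4 /E5 /E6 ?x0; ring.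
  by rewrite ?e0 ?e1 ?e2 ?e3 ?e4 ?e5 ?e6; ring.
have x2 : coord xi 2 = 0.
  apply: (mulfI n).
  transitivity (90 * E0 + 1170 * E1 + 360 * E2 + 36 * E3 - 72 * E4 - 72 * E5 + 6 * E6).
    by rewrite /E0 /E1 /E2 /E3 /E4 /E5 /E6 ?x0; ring.
  by rewrite ?e0 ?e1 ?e2 ?e3 ?e4 ?e5 ?e6; ring.
have x3 : coord xi 3 = 0.
  apply: (mulfI n).
  transitivity (15 * E0 + 195 * E1 + 60 * E2 + 6 * E3 + 204 * E4 - 76 * E5 + E6).
    by rewrite /E0 /E1 /E2 /E3 /E4 /E5 /E6 ?x0; ring.
  by rewrite ?e0 ?e1 ?e2 ?e3 ?e4 ?e5 ?e6; ring.
have x4 : coord xi 4 = 0.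
  apply: (mulfI n).
  transitivity (105 * E0 + 495 * E1 + 420 * E2 + 54 * E3 - 84 * E4 - 84 * E5 + 9 * E6).
    by rewrite /E0 /E1 /E2 /E3 /E4 /E5 /E6 ?x0; ring.
  by rewrite ?e0 ?e1 ?e2 ?e3 ?e4 ?e5 ?e6; ring.
have x5 : coord xi 5 = 0.
  apply: (mulfI n).
  transitivity (- 15 * E0 - 195 * E1 - 60 * E2 - 6 * E3 - 60 * E4 - 20 * E5 - E6).
    by rewrite /E0 /E1 /E2 /E3 /E4 /E5 /E6 ?x0; ring.
  by rewrite ?e0 ?e1 ?e2 ?e3 ?e4 ?e5 ?e6; ring.
have x6 : coord xi 6 = 0.
  apply: (mulfI n).
  transitivity (- 30 * E0 + 180 * E1 + 120 * E2 + 96 * E4 - 24 * E5).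
    by rewrite /E0 /E1 /E2 /E3 /E4 /E5 /E6 ?x0; ring.
  by rewrite ?e0 ?e1 ?e2 ?e3 ?e4 ?e5 ?e6; ring.
have x7 : coord xi 7 = 0.
  apply: (mulfI n).
  transitivity (15 * E0 + 45 * E1 + 60 * E2 + 18 * E3 - 12 * E4 - 12 * E5 + 3 * E6).
    by rewrite /E0 /E1 /E2 /E3 /E4 /E5 /E6 ?x0; ring.
  by rewrite ?e0 ?e1 ?e2 ?e3 ?e4 ?e5 ?e6; ring.
apply/matrixP => k j; rewrite ord1 mxE.
case: k; do 8?[case=> [h | ]]; last by [].
- by rewrite (bool_irrelevance h isT).
- by rewrite (bool_irrelevance h isT).
- by rewrite (bool_irrelevance h isT).
- by rewrite (bool_irrelevance h isT).
- by rewrite (bool_irrelevance h isT).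
- by rewrite (bool_irrelevance h isT).
- by rewrite (bool_irrelevance h isT).
- by rewrite (bool_irrelevance h isT).
Qed.

(** A small integral multiple of [heptagon_sol] at the sample point, which avoids evaluating the
    maximal minors. *)
Definition sample_sol : 'cV[F]_8 := \col_k nth 0 [:: - 2; - 1; 6; 1; 9; - 1; 0; 3] k.

Lemma sample_solP : heptagon_mx sample_point *m sample_sol = 0.
Proof.
apply/heptagon_mxP => i.
suff [j <- K0] : exists2 j, ordS i = j & kernel sample_point sample_sol i j = 0 by [].
case: i; do 7?[case=> [h | ]]; last by [].
- by exists (o 1); [apply: val_inj | sample_kernel; rewrite !mxE /=; ring].
- by exists (o 2); [apply: val_inj | sample_kernel; rewrite !mxE /=; ring].
- by exists (o 3); [apply: val_inj | sample_kernel; rewrite !mxE /=; ring].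
- by exists (o 4); [apply: val_inj | sample_kernel; rewrite !mxE /=; ring].
- by exists (o 5); [apply: val_inj | sample_kernel; rewrite !mxE /=; ring].
- by exists (o 6); [apply: val_inj | sample_kernel; rewrite !mxE /=; ring].
- by exists (o 0); [apply: val_inj | sample_kernel; rewrite !mxE /=; ring].
Qed.

Definition sample_table (i j : nat) : F := nth 0 (nth [::] [:: [:: - 5040; 0; - 80; - 290];
    [:: 0; 48; 0; - 30];
    [:: 80; 0; - 144; 0];
    [:: 290; 30; 0; - 360];
    [:: 1650; 30; 120; 0];
    [:: - 270; - 42; 76; - 80];
    [:: 0; 240; 160; 1300]] i) j.

Definition sample_residue (i : nat) : F :=
  nth 0 [:: 720; 48; 48; - 120; - 120; - 36; 720] i.

Lemma sample_tableE (i : 'I_7) (j : 'I_4) :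
  kernel sample_point sample_sol i (widen_ord (isT : (4 <= 7)%N) j) = sample_table i j.
Proof.
case: i; do 7?[case=> [h | ]]; last by [].
all: case: j; do 4?[case=> [h' | ]]; last by [].
all: by rewrite /sample_table; sample_kernel; rewrite !mxE /=; ring.
Qed.

Lemma sample_residueE (i : 'I_7) :
  \prod_(k < 7 | k != i) (sample_point i - sample_point k) = sample_residue i.
Proof.
rewrite big_mkcond !big_ord_recl big_ord0 /sample_point /sample_residue.
by case: i; do 7?[case=> [h | ]] => //=; ring.
Qed.

Lemma sample_gram_unit : residue_gram sample_point sample_sol \in unitmx.
Proof.
pose g j l := \sum_(i < 7) sample_table i j * sample_table i l / sample_residue i.
have gE (j l : 'I_4) : residue_gram sample_point sample_sol j l = g j l.
  by rewrite mxE; apply: eq_bigr => i _; rewrite !sample_tableE sample_residueE.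
have gC j l : g j l = g l j by apply: eq_bigr => i _; rewrite [_ * sample_table i l]mulrC.
have g00 : g 0%N 0%N = 10000.
  by rewrite /g !big_ord_recl big_ord0 /sample_table /sample_residue /=; field.
have g01 : g 0%N 1%N = - 800.
  by rewrite /g !big_ord_recl big_ord0 /sample_table /sample_residue /=; field.
have g02 : g 0%N 2%N = - 760.
  by rewrite /g !big_ord_recl big_ord0 /sample_table /sample_residue /=; field.
have g03 : g 0%N 3%N = 2300.
  by rewrite /g !big_ord_recl big_ord0 /sample_table /sample_residue /=; field.
have g11 : g 1%N 1%N = 64.
  by rewrite /g !big_ord_recl big_ord0 /sample_table /sample_residue /=; field.
have g12 : g 1%N 2%N = 112.
  by rewrite /g !big_ord_recl big_ord0 /sample_table /sample_residue /=; field.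
have g13 : g 1%N 3%N = 400.
  by rewrite /g !big_ord_recl big_ord0 /sample_table /sample_residue /=; field.
have g22 : g 2%N 2%N = 196.
  by rewrite /g !big_ord_recl big_ord0 /sample_table /sample_residue /=; field.
have g23 : g 2%N 3%N = 490.
  by rewrite /g !big_ord_recl big_ord0 /sample_table /sample_residue /=; field.
have g33 : g 3%N 3%N = 1225.
  by rewrite /g !big_ord_recl big_ord0 /sample_table /sample_residue /=; field.
rewrite -row_free_unit; apply/inj_row_free => u uG.
pose c k := u 0 (inord k).
have uE k : u 0 k = c k by rewrite /c inord_val.
pose E0 := 10000 * c 0%N - 800 * c 1%N - 760 * c 2%N + 2300 * c 3%N.
have e0 : E0 = 0.
  have /matrixP/(_ 0 (@Ordinal 4 0 isT)) := uG; rewrite mxE [RHS]mxE !big_ord_recl big_ord0.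
  rewrite !gE !uE /= /bump /= !add1n (gC 1%N 0%N) (gC 2%N 0%N) (gC 3%N 0%N) g00 g01 g02 g03 => <-.
  by rewrite /E0; ring.
pose E1 := - 800 * c 0%N + 64 * c 1%N + 112 * c 2%N + 400 * c 3%N.
have e1 : E1 = 0.
  have /matrixP/(_ 0 (@Ordinal 4 1 isT)) := uG; rewrite mxE [RHS]mxE !big_ord_recl big_ord0.
  rewrite !gE !uE /= /bump /= !add1n (gC 2%N 1%N) (gC 3%N 1%N) g01 g11 g12 g13 => <-.
  by rewrite /E1; ring.
pose E2 := - 760 * c 0%N + 112 * c 1%N + 196 * c 2%N + 490 * c 3%N.
have e2 : E2 = 0.
  have /matrixP/(_ 0 (@Ordinal 4 2 isT)) := uG; rewrite mxE [RHS]mxE !big_ord_recl big_ord0.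
  rewrite !gE !uE /= /bump /= !add1n (gC 3%N 2%N) g02 g12 g22 g23 => <-.
  by rewrite /E2; ring.
pose E3 := 2300 * c 0%N + 400 * c 1%N + 490 * c 2%N + 1225 * c 3%N.
have e3 : E3 = 0.
  have /matrixP/(_ 0 (@Ordinal 4 3 isT)) := uG; rewrite mxE [RHS]mxE !big_ord_recl big_ord0.
  rewrite !gE !uE /= /bump /= !add1n g03 g13 g23 g33 => <-.
  by rewrite /E3; ring.
have n m : (0 < m)%N -> m%:R != 0 :> F by rewrite pnatr_eq0 lt0n.
(* Elimination: each of the next three relations removes two unknowns from two of the equations, and
   with E1 they leave only [c 3]. *)
have h1 : 35 * c 0%N + c 1%N = 0.
  apply: (mulfI (n 240 isT)); transitivity (2 * E3 - 5 * E2); first by rewrite /E2 /E3; ring.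
  by rewrite e2 e3; ring.
have h2 : 64 * c 0%N - 21 * c 3%N = 0.
  apply: (mulfI (n 80 isT)); transitivity (8 * E2 - 14 * E1); first by rewrite /E1 /E2; ring.
  by rewrite e1 e2; ring.
have h3 : 32 * c 2%N + 365 * c 3%N = 0.
  apply: (mulfI (n 40 isT)); transitivity (2 * E0 + 25 * E1); first by rewrite /E0 /E1; ring.
  by rewrite e0 e1; ring.
have c3 : c 3%N = 0.
  apply: (mulfI (n 3750 isT)).
  transitivity (128 * (35 * c 0%N + c 1%N) + 7 * (32 * c 2%N + 365 * c 3%N) - 2 * E1
    - 95 * (64 * c 0%N - 21 * c 3%N)); first by rewrite /E1; ring.
  by rewrite h1 h2 h3 e1; ring.
have c0 : c 0%N = 0 by apply: (mulfI (n 64 isT)); rewrite mulr0 -[RHS]h2 c3; ring.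
have c1 : c 1%N = 0 by rewrite -[RHS]h1 c0; ring.
have c2 : c 2%N = 0 by apply: (mulfI (n 32 isT)); rewrite mulr0 -[RHS]h3 c3; ring.
apply/rowP => k; rewrite uE mxE.
by move: (nat_of_ord k) (ltn_ord k); do 5?[case=> //].
Qed.

End SamplePoint.

(** * The conic *)

Section ProjectivePoints.
Variables (F : fieldType) (n : nat).

Lemma proj_eq_line (p : proj F n) : exists2 y : 'rV[F]_n.+1, y != 0 & val p = <[y]>%VS.
Proof.
have dp : \dim (val p) = 1%N := eqP (valP p).
exists (vpick (val p)); first by rewrite vpick0 -dimv_eq0 dp.
apply/esym/eqP; rewrite eqEdim dp dim_vline vpick0 -dimv_eq0 dp /= andbT.
by rewrite -memvE memv_pick.
Qed.

Lemma line_proj (y : 'rV[F]_n.+1) : y != 0 -> exists p : proj F n, val p = <[y]>%VS.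
Proof.
move=> y0; have dy : \dim <[y]> == 1%N by rewrite dim_vline y0.
by exists (exist _ <[y]>%VS dy).
Qed.

(** The trace of the first quadric alone; on a plane isotropic for D with a != 0 the second quadric
    is a multiple of the first. *)
Definition isotropic_points (A : 'M[F]_(3, n.+1)) : set (proj F n) :=
  [set p : proj F n | forall y : 'rV[F]_n.+1, y \in val p ->
     (y <= A)%MS /\ (y *m y^T) = 0].

Lemma isotropic_pointsE (A : 'M[F]_(3, n.+1)) (Q : 'M[F]_3) :
  (forall v, qform Q v = 0 <-> qform (A *m A^T) v = 0) ->
  [set p : proj F n | exists2 v : 'rV[F]_3,
     qform Q v = 0 & val p = <[v *m A]>%VS] = isotropic_points A.
Proof.
move=> QA.
have E v : qform (A *m A^T) v = 0 <-> (v *m A) *m (v *m A)^T = 0.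
  by rewrite -bform_eq0 /bform /qform trmx_mul !mulmxA.
apply/seteqP; split=> p /=.
  case=> v /QA/E vA pE y; rewrite /= pE => /vlineP [] k ->; split.
    by rewrite scalemx_sub // submxMl.
  by rewrite linearZ /= -scalemxAl -scalemxAr vA !scaler0.
move=> pA; have [y y0 pE] := proj_eq_line p.
have [] := pA y; first by rewrite /= pE memv_line.
case/submxP => v yE yy; exists v; last by rewrite -yE.
by apply/QA/E; rewrite -yE.
Qed.

End ProjectivePoints.

Lemma smooth_conicP (F : fieldType) (n : nat) (C : set (proj F n)) :
  2%:R != 0 :> F -> smooth_conic C <->
  exists (A : 'M[F]_(3, n.+1)) (Q : 'M[F]_3),
    [/\ row_free A, Q^T = Q, smooth_form Q
      & C = [set p : proj F n | exists2 v : 'rV[F]_3,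
                       qform Q v = 0 & val p = <[v *m A]>%VS]].
Proof.
move=> two_neq0; split.
  case=> A [] q [] Afree q2 qsm CE; have [Q Qs qE] := homog2_quad_mpoly two_neq0 q2.
  exists A, Q; split=> //.
    move=> v v0 Qv; have [|i] := qsm v v0; first by rewrite qE meval_quad_mpoly.
    rewrite qE mderiv_quad_mpoly //; apply: contraNneq => ->.
    by rewrite mxE mulr0.
  by rewrite CE qE; apply/seteqP; split=> p /= [] v Qv pE; exists v => //;
    move: Qv; rewrite meval_quad_mpoly.
case=> A [] Q [] Afree Qs Qsm CE; exists A, (quad_mpoly Q); split=> //.
- exact: quad_mpoly_homog.
- move=> v v0; rewrite meval_quad_mpoly => /(Qsm v v0)/rV0Pn [] i vQi.
  by exists i; rewrite mderiv_quad_mpoly // mulf_neq0.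
by rewrite CE; apply/seteqP; split=> p /= [] v Qv pE; exists v => //;
  move: Qv; rewrite meval_quad_mpoly.
Qed.

(** * ** Existence and uniqueness for generic parameters *)

Section MainProof.
Variables (F : fieldType) (lam s : 'I_7 -> F).
Hypotheses (two_neq0 : 2%:R != 0 :> F) (three_neq0 : 3%:R != 0 :> F).
Hypotheses (lam_generic : genericity lam != 0) (s_sqrt : is_sqrt_choice lam s).

Local Notation S := (moment_mx lam s 3).
Local Notation D := (pencil_mx lam).
Local Notation sol := (heptagon_sol lam).
Local Notation L := (polar_mx lam s sol).

Lemma generic_inj : injective lam.
Proof.
by apply/prod_diff_neq0; move: lam_generic; rewrite !mulf_eq0 !negb_or => /andP [] /andP [].
Qed.

Lemma generic_sol0 : coord sol 0 != 0.
Proof. by move: lam_generic; rewrite !mulf_eq0 !negb_or => /andP [] /andP []. Qed.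

Lemma generic_minor : (polar_minor lam s sol)^T *m polar_minor lam s sol \in unitmx.
Proof.
apply: (residue_gram_polar generic_inj s_sqrt).
move: lam_generic; rewrite !mulf_eq0 !negb_or => /andP [] _.
by rewrite (kernel_gramE generic_inj) detZ mulf_eq0 negb_or unitmxE unitfE => /andP [].
Qed.

Lemma generic_no_degenerate (xi : 'cV[F]_8) : heptagon_mx lam *m xi = 0 ->
  coord xi 0 = 0 -> coord xi 1 = 0 -> xi = 0.
Proof.
by move=> xiP xi0 _; rewrite (heptagon_ker generic_sol0 xiP) xi0 mul0r scale0r.
Qed.

Lemma sum_sqrE (y : 'rV[F]_7) a b :
  (y *m D a b *m y^T) 0 0 = b * (\sum_i y 0 i ^+ 2) - a * \sum_i lam i * y 0 i ^+ 2.
Proof.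
rewrite mxE !mulr_sumr -sumrB; apply: eq_bigr => j _.
by rewrite pencil_mxE mxE; ring.
Qed.

Lemma sqr_normE (y : 'rV[F]_7) : (y *m y^T = 0) <-> (\sum_i y 0 i ^+ 2 = 0).
Proof.
have E : (y *m y^T) 0 0 = \sum_i y 0 i ^+ 2.
  by rewrite mxE; apply: eq_bigr => j _; rewrite mxE expr2.
by split=> [y0|y0]; [rewrite -E y0 mxE | apply/matrixP => i j; rewrite !ord1 E y0 mxE].
Qed.

Lemma eqmx_isotropic_points (A A' : 'M[F]_(3, 7)) :
  (A :=: A')%MS -> isotropic_points A = isotropic_points A' :> set (proj F 6).
Proof.
by move=> AA; apply/seteqP; split=> p pA y /pA [yA yy]; rewrite AA ?yA -?AA ?yA in yA *.
Qed.

Lemma heptagon_conic_exists : exists A : 'M[F]_(3, 7),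
  [/\ (A :=: kermx (polar_minor lam s sol))%MS, A *m A^T \in unitmx,
      smooth_conic (isotropic_points A : set (proj F 6)),
      isotropic_points A `<=` two_quadrics lam
    & forall i : 'I_7,
        isotropic_points A `&` plane_S lam s [set i; ordS i]%SET !=set0].
Proof.
have lam_inj := generic_inj; have sol0 := generic_sol0.
have sol_cyc : forall i, L i (ordS i) = 0.
  by apply/(heptagon_polar_mx lam_inj s_sqrt); apply: heptagon_solP.
have [A [Afree AK Au]] := polar_plane generic_minor.
have AL : A *m L = 0.
  apply/eqP; rewrite -(mul_polar_minor_eq0 _ lam_inj s_sqrt).
  by apply/eqP/sub_kermxP; rewrite AK.
exists A; split=> //.
- apply/(smooth_conicP _ two_neq0); exists A, (A *m A^T); split=> //.
  + by rewrite trmx_mul trmxK.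
  + move=> v v0 _; apply: contraNneq v0 => vA.
    by rewrite -(mulmxK Au v) vA mul0mx.
  + by rewrite isotropic_pointsE.
- move=> p pA y /pA [/submxP [u yE] /sqr_normE yy]; split=> //.
  have := polar_ker_isotropic lam_inj s_sqrt two_neq0 AL AL.
  move=> /(congr1 (fun M => (u *m M *m u^T) 0 0)).
  rewrite mulmx0 mul0mx !mulmxA -mulmxA -trmx_mul -yE sum_sqrE yy mulr0 sub0r [RHS]mxE.
  by move/eqP; rewrite oppr_eq0 mulf_eq0 (negPf sol0) => /eqP.
move=> i; have [f [f0 fS fL]] := polar_ker_meets_plane lam_inj s_sqrt two_neq0 sol_cyc i.
set I := [set i; ordS i]%SET in fL *.
have [|p pE] := @line_proj F 6 (flip I f); first by rewrite flip_eq0.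
exists p; split=> y; rewrite /= pE => /vlineP [] k ->.
  split; first by rewrite scalemx_sub // AK; apply/sub_kermxP/eqP;
    rewrite (mul_polar_minor_eq0 _ lam_inj s_sqrt) fL.
  rewrite linearZ /= -scalemxAl -scalemxAr (_ : flip I f *m _ = 0) ?scaler0 //.
  (* Sign changes preserve the squares, and S lies on the first quadric, the member (a, b) = (0, 1)
     of the pencil. *)
  apply/sqr_normE; transitivity (\sum_j f 0 j ^+ 2).
    by apply: eq_bigr => j _; rewrite /flip mxE; case: ifP; rewrite ?sqrrN.
  case/submxP: fS => u ->; have := moment_mx_isotropic lam_inj s_sqrt 0 1.
  move=> /(congr1 (fun M => (u *m M *m u^T) 0 0)).
  by rewrite mulmx0 mul0mx !mulmxA -mulmxA -trmx_mul sum_sqrE mul0r subr0 mul1r mxE.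
apply/(in_SP lam_inj s_sqrt).
by rewrite -flip_mxE -scalemxAl flip_mxE flipK scalemx_sub.
Qed.

Lemma heptagon_conic_unique (C : set (proj F 6)) :
  smooth_conic C -> C `<=` two_quadrics lam ->
  (forall i : 'I_7, C `&` plane_S lam s [set i; ordS i]%SET !=set0) ->
  forall A : 'M[F]_(3, 7), (A :=: kermx (polar_minor lam s sol))%MS ->
    A *m A^T \in unitmx -> isotropic_points A = C.
Proof.
have lam_inj := generic_inj; have sol0 := generic_sol0.
move=> /(smooth_conicP _ two_neq0) [A' [Q [A'free Qs Qsm CE]]] CX CS A AK Au.
have Cpt v : v != 0 -> qform Q v = 0 -> exists2 p, C p & val p = <[v *m A']>%VS.
  move=> v0 Qv; have [|p pE] := @line_proj F 6 (v *m A').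
    apply: contraNneq v0 => vA; apply/eqP; apply: (row_free_inj A'free).
    by rewrite vA mul0mx.
  by exists p => //; rewrite CE /=; exists v.
have meets i : exists v : 'rV[F]_3,
    [/\ v != 0, qform Q v = 0 & (flip [set i; ordS i]%SET (v *m A') <= S)%MS].
  have [p [Cp pS]] := CS i; have := Cp; rewrite CE => -[] v Qv pE.
  exists v; split=> //.
    have /eqP := valP p; rewrite -/(val p) pE dim_vline.
    by apply: contra_eqN => /eqP ->; rewrite mul0mx eqxx.
  by apply/(in_SP lam_inj s_sqrt)/pS; rewrite /= pE memv_line.
have [u [u0 Qu _]] := meets 0.
(* [D (- 1) 0] is diag(lam), so G1 and G2 are the restrictions of the two quadrics to the plane of
   C; both vanish on C and are multiples of Q. *)
pose Lam := D (- 1) 0; pose G1 := A' *m A'^T; pose G2 := A' *m Lam *m A'^T.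
have Gv v : qform Q v = 0 -> qform G1 v = 0 /\ qform G2 v = 0.
  move=> Qv; have [->|v0] := eqVneq v 0; first by rewrite /qform !mul0mx mxE.
  have [p Cp pE] := Cpt v v0 Qv; have [] := CX p Cp (v *m A').
    by rewrite /= pE memv_line.
  move=> y1 y2; have E : v *m G2 *m v^T = v *m A' *m Lam *m (v *m A')^T.
    by rewrite /G2 trmx_mul !mulmxA.
  split; last by rewrite /qform E sum_sqrE mul0r sub0r mulN1r opprK.
  have /sqr_normE y0 := y1; rewrite /qform /G1 !mulmxA -mulmxA -trmx_mul y0 mxE //.
have [c1 G1E] : exists c, G1 = c *: Q.
  apply: (smooth_qform_dvd two_neq0 three_neq0 Qs Qsm u0 Qu).
    by rewrite /G1 trmx_mul trmxK.
  by move=> v /Gv [].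
have [c2 G2E] : exists c, G2 = c *: Q.
  apply: (smooth_qform_dvd two_neq0 three_neq0 Qs Qsm u0 Qu).
    by rewrite /G2 !trmx_mul trmxK tr_pencil_mx mulmxA.
  by move=> v /Gv [].
have GD a b : A' *m D a b *m A'^T = (b * c1 - a * c2) *: Q.
  have -> : D a b = b *: 1%:M - a *: Lam.
    apply/matrixP => i j; rewrite !mxE; case: eqP => _; rewrite ?mulr1n ?mulr0n; ring.
  rewrite mulmxBr mulmxBl -!scalemxAr -!scalemxAl mulmx1 -/G1 -/G2 G1E G2E.
  by rewrite !scalerA -scalerBl.
(* The member (a, b) = (c1, c2) restricts to 0 on the plane; if c1 = c2 = 0 every member does, and
   (1, 0) is taken. *)
have [[a b] ab ab0] : exists2 ab : F * F, ab != (0, 0) & A' *m D ab.1 ab.2 *m A'^T = 0.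
  have [c0|c0] := eqVneq (c1, c2) (0, 0).
    by case: c0 => c10 c20; exists (1, 0); rewrite ?GD ?c10 ?c20 ?mulr0 ?subr0 ?scale0r //
      xpair_eqE oner_eq0.
  by exists (c1, c2); rewrite // GD /= mulrC subrr scale0r.
rewrite /= in ab0.
have A'_meets i : exists f : 'rV[F]_7,
    [/\ f != 0, (f <= S)%MS & (flip [set i; ordS i]%SET f <= A')%MS].
  have [v [v0 Qv vS]] := meets i; exists (flip [set i; ordS i]%SET (v *m A')).
  split=> //; last by rewrite flipK submxMl.
  rewrite flip_eq0; apply: contraNneq v0 => vA; apply/eqP; apply: (row_free_inj A'free).
  by rewrite vA mul0mx.
have [AS|AS] := eqVneq (A' :&: S)%MS 0; last first.
  have A'S := isotropic_plane_eqS lam_inj s_sqrt two_neq0 generic_no_degenerate ab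
    A'free ab0 A'_meets AS.
  by case: (no_conic_in_S lam_inj s_sqrt two_neq0 generic_no_degenerate A'free Qs Qsm A'S).
have [xi [xi0 xi1 xiP xiA]] :=
  isotropic_plane_polar lam_inj s_sqrt two_neq0 A'free ab0 A'_meets AS.
have xiE := heptagon_ker sol0 xiP; set k := _ / _ in xiE.
have k0 : k != 0.
  apply: contraNneq ab => k0; rewrite -xi0 -xi1 xiE k0 scale0r !mxE //.
have LE : polar_mx lam s xi = k *: L.
  by apply/matrixP => i j; rewrite xiE !mxE /kernel -scalemxAr mxE mulrA.
have A'L : A' *m L = 0.
  by apply: (scalerI k0); rewrite scaler0 scalemxAr -LE.
have A'A : (A' <= A)%MS.
  rewrite AK; apply/sub_kermxP/eqP.
  by rewrite (mul_polar_minor_eq0 _ lam_inj s_sqrt) A'L.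
have AA' : (A <= A')%MS.
  by rewrite -(mxrank_leqif_sup A'A) eqn_leq mxrankS // (eqP A'free) rank_leq_row.
have AeqA' : (A :=: A')%MS by apply/eqmxP; rewrite AA' A'A.
rewrite (eqmx_isotropic_points AeqA') CE; apply/esym/isotropic_pointsE => v.
(* If the first quadric vanished on the plane, the invertible matrix A A^T would be 0. *)
have c10 : c1 != 0.
  apply: contraTneq Au => c10; have /submxP [T ->] := AA'.
  rewrite trmx_mul mulmxA -(mulmxA T) -/G1 G1E c10 scale0r mulmx0 mul0mx.
  by rewrite unitmxE det0 unitr0.
have qZ : qform (c1 *: Q) v = c1 * qform Q v by rewrite /qform -scalemxAr -scalemxAl mxE.
rewrite -/G1 G1E qZ; split=> [->|/eqP]; first by rewrite mulr0.
by rewrite mulf_eq0 (negPf c10) => /eqP.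
Qed.

End MainProof.

(** The Gram determinant is computed on [sample_sol]; this vector is a multiple of [heptagon_sol]
    and the Gram matrix is quadratic in it, so nonvanishing carries over. *)
Lemma sample_genericity (F : numFieldType) : genericity (@sample_point F) != 0.
Proof.
have inj := @sample_point_inj F; set lam := @sample_point F in inj *.
have sol0 : coord (heptagon_sol lam) 0 != 0.
  rewrite -det_heptagon -det_tr -unitfE -unitmxE -row_free_unit.
  apply/inj_row_free => u; set M := col_mx _ _ => uM.
  have Mu : M *m u^T = 0 by rewrite -[M]trmxK -trmx_mul uM trmx0.
  move: Mu; rewrite mul_col_mx -[RHS]col_mx0 => /eq_col_mx [] u0 uH.
  suff : u^T = 0 by move/(congr1 trmx); rewrite trmxK trmx0.
  apply: (sample_no_degenerate uH).
  move: u0; rewrite -rowE => /matrixP/(_ 0 0); rewrite !mxE => u0.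
  by rewrite -[RHS]u0; congr (u 0 _); apply: val_inj.
rewrite /genericity !mulf_neq0 //; first by apply/prod_diff_neq0.
have [k kE] : exists k, sample_sol F = k *: heptagon_sol lam.
  by eexists; apply: (heptagon_ker sol0 (sample_solP F)).
rewrite (kernel_gramE inj) detZ mulf_neq0 ?expf_neq0 //; first by apply/prod_diff_neq0.
have := sample_gram_unit F; rewrite -/lam kE unitmxE unitfE.
have -> : residue_gram lam (k *: heptagon_sol lam) =
    k ^+ 2 *: residue_gram lam (heptagon_sol lam).
  apply/matrixP => j l; rewrite !mxE mulr_sumr; apply: eq_bigr => i _.
  have kZ m : kernel lam (k *: heptagon_sol lam) i m = k * kernel lam (heptagon_sol lam) i m.
    by rewrite /kernel -scalemxAr [LHS]mxE.
  by rewrite !kZ; ring.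
by rewrite detZ mulf_eq0 negb_or => /andP [].
Qed.

Lemma genericity_open (F : fieldType) :
  zariski_open [set lam : 'I_7 -> F | genericity lam != 0].
Proof.
exists [set genericity (fun i => 'X_i : {mpoly F[7]})]; apply/seteqP.
have E lam : (genericity (fun i => 'X_i : {mpoly F[7]})).@[lam] = genericity lam.
  rewrite (rmorph_genericity (meval lam)); congr genericity.
  by apply/funext => i; rewrite /= mevalXU.
split=> lam /=; first by move=> g0; exists (genericity (fun i => 'X_i)); rewrite ?E.
by case=> _ ->; rewrite E.
Qed.

(* ordS i is i + 1 modulo 7. *)
Theorem theorem1p7 (R : realType) :
  exists U : set ('I_7 -> R[i]),
    [/\ zariski_open U, U !=set0, (forall lam, U lam -> injective lam)
      & forall lam, U lam -> forall s, is_sqrt_choice lam s ->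
          exists! C : set (proj R[i] 6),
            [/\ smooth_conic C,
                C `<=` two_quadrics lam
              & forall i : 'I_7,
                  C `&` plane_S lam s [set i; ordS i]%SET !=set0]].
Proof.
exists [set lam | genericity lam != 0]; split.
- exact: genericity_open.
- by exists (sample_point R[i]); apply: sample_genericity.
- by move=> lam; apply: generic_inj.
move=> lam /= lam_generic s s_sqrt.
have two_neq0 : 2%:R != 0 :> R[i] by rewrite pnatr_eq0.
have three_neq0 : 3%:R != 0 :> R[i] by rewrite pnatr_eq0.
have [A [AK Au Csm CX CS]] := heptagon_conic_exists two_neq0 lam_generic s_sqrt.
exists (isotropic_points A); split=> [//|C [C'sm C'X C'S]].
exact: (heptagon_conic_unique two_neq0 three_neq0 lam_generic s_sqrt C'sm C'X C'S AK Au).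
Qed.
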